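(* For all non-negative integers $m,n$, $$|\{A \in \mathrm{ASM}(n) : \mu(A)=m\}| = |\{A \in \mathrm{DASASM}(2n+1) : N_{-1}(A)=n,\ \mu_{\nabla}(A)=m \}|.$$ That is, the distribution of $\mu$ on $\mathrm{ASM}(n)$ equals the distribution of $\mu_\nabla$ on the set of $A\in \mathrm{DASASM}(2n+1)$ with $N_{-1}(A)=n$.
   Context: An alternating sign matrix (ASM) of order $m$ is an $m\times m$ matrix with entries in $\{0,1,-1\}$ such that along each row and each column the non-zero entries alternate in sign and add up to $1$; $\mathrm{ASM}(m)$ is the set of all of them (for $m=0$ there is one, the empty matrix). $\mathrm{DASASM}(m)$ is the set of ASMs of order $m$ that are invariant under reflection in the main diagonal and in the main antidiagonal. The fundamental triangle of $A=(a_{i,j})\in\mathrm{DASASM}(2n+1)$ is the set of positions $\{(i,j): 1\le i\le n+1,\ i\le j\le 2n+2-i\}$. $N_{-1}(A)$ is the number of entries $-1$ of $A$ among the positions $(i,i)$ and $(i,2n+2-i)$ for $1\le i\le n$, and $(n+1,n+1)$ (the part of the two diagonals lying in the fundamental triangle). For an ASM $A$, $\mu(A)$ is the number of $-1$'s in $A$. For $A\in\mathrm{DASASM}(2n+1)$, $\mu_\nabla(A)$ is the number of $-1$'s in the fundamental triangle of $A$, minus $n$. *)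

(* Defs.v *)
From mathcomp Require Import all_boot all_order all_algebra.
Set Implicit Arguments.
Unset Strict Implicit.
Unset Printing Implicit Defensive.
Import Order.TTheory GRing.Theory Num.Theory.
Local Open Scope ring_scope.

(* The subtype {0, 1, -1} of int, so that matrices over it form a finType;
   \val embeds it into int. *)
Definition entry : Type := seq_sub [:: 0; 1; -1 : int].

Definition int_mx m (A : 'M[entry]_m) : 'M[int]_m := map_mx \val A.

Definition alternating (s : seq int) : bool :=
  sorted (fun x y => y == - x) [seq x <- s | x != 0].

Definition asm_line (s : seq int) : bool :=
  alternating s && (\sum_(x <- s) x == 1).

(* enum 'I_m is increasing, so lines are read in their natural order. *)
Definition row_seq m (A : 'M[int]_m) (i : 'I_m) : seq int :=
  [seq A i j | j <- enum 'I_m].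

Definition col_seq m (A : 'M[int]_m) (j : 'I_m) : seq int :=
  [seq A i j | i <- enum 'I_m].

Definition ASM (m : nat) : {set 'M[entry]_m} :=
  [set A | [forall i, asm_line (row_seq (int_mx A) i)]
        && [forall j, asm_line (col_seq (int_mx A) j)]].

Definition diag_reflection T m (A : 'M[T]_m) : 'M[T]_m := A^T.

Definition antidiag_reflection T m (A : 'M[T]_m) : 'M[T]_m :=
  \matrix_(i, j) A (rev_ord j) (rev_ord i).

Definition DASASM (m : nat) : {set 'M[entry]_m} :=
  [set A in ASM m | (diag_reflection A == A) && (antidiag_reflection A == A)].

(* Positions are 0-based: the 1-based position (i, j) is the pair (i-1, j-1),
   so i <= j <= 2n+2-i becomes i <= j <= 2n-i. *)
Definition fundamental_triangle (n : nat) :=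
  [set p : 'I_(n.*2.+1) * 'I_(n.*2.+1) | [&& p.1 <= n, p.1 <= p.2 & p.2 <= n.*2 - p.1]%N].

(* rev_ord i is 2n - i, i.e. 2n+2-i for 1-based indices. *)
Definition triangle_diagonals (n : nat) :=
  [set p : 'I_(n.*2.+1) * 'I_(n.*2.+1) | ((p.1 < n)%N && ((p.2 == p.1) || (p.2 == rev_ord p.1)))
        || ((p.1 == n :> nat) && (p.2 == n :> nat))].

Definition minus_ones m (P : {set 'I_m * 'I_m}) (A : 'M[entry]_m) : nat :=
  #|[set p in P | int_mx A p.1 p.2 == -1]|.

Definition mu m (A : 'M[entry]_m) : nat := minus_ones [set: 'I_m * 'I_m] A.

Definition N_minus1 n (A : 'M[entry]_(n.*2.+1)) : nat :=
  minus_ones (triangle_diagonals n) A.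

Definition mu_nabla n (A : 'M[entry]_(n.*2.+1)) : int :=
  (minus_ones (fundamental_triangle n) A)%:Z - n%:Z.

(* Main.v *)
(** A line of an alternating sign matrix is a sequence with entries in {0, 1, -1} whose partial
    sums stay in {0, 1} and end at 1.  In the fundamental triangle of a DASASM let [d_j] be the
    diagonal entry of column [j] and [c_j] the sum of the entries above it.  The row sums give
    [sum_(j <> n) (2 c_j + d_j) = n - c_n], while [d_j = -1] contributes at most [2 c_j + d_j] to
    [N_{-1}], with equality exactly when [d_j = - c_j]; and the centre contributes [c_n].  Hence
    [N_{-1} = n] means that [d_j = - c_j] for all [j], i.e. that the matrix is determined by the
    interior of its fundamental triangle, which is an arbitrary triangular array whose rows are
    ASM lines, whose columns have partial sums in {0, 1}, and whose central column sums to 1.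
    The statistic counts the entries -1 of this array.

    Such arrays, with weight [x] for every -1, are the states of a six-vertex model on a triangle
    with two reflecting walls.  Its partition function [Z(u_1, ..., u_n; w)], in which [w] is the
    parameter of the central column, is symmetric in the [u_i] by the Yang-Baxter and reflection
    equations.  If [w = 1 / u_i], or [w = 1 / (Q^2 u_i)], the line [u_i] can be frozen on one side
    and pushed through the triangle on the other, which expresses [Z] by the smaller partition
    function whose central parameter is [u_i].  When [u_n] equals the parameter [T] of the walls,
    the partition function of [n x n] ASMs with row parameters [u_1, ..., u_n] and column
    parameters [u_1, ..., u_(n-1), w] satisfies the same recursion up to explicit factors.  Both
    sides have degree less than [n] in [w], so they agree by interpolation.  Specializing all
    parameters to [1 / q], with [Q = q^2], yields the weight [x = (q + 1/q)^2] for each -1, for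
    infinitely many values of [x]. *)

Require Import Defs.
From mathcomp Require Import all_boot all_order all_algebra.
From mathcomp Require Import ring zify.
From Stdlib Require Import FunctionalExtensionality.

Set Implicit Arguments.
Unset Strict Implicit.
Unset Printing Implicit Defensive.
Import Order.TTheory GRing.Theory Num.Theory.

(** * Six-vertex weights and local relations *)

Section LocalOperators.

Local Open Scope ring_scope.
Variable R : comNzRingType.
Implicit Types (f g : seq bool -> R) (s t : seq bool) (M : seq bool -> seq bool -> R).

Fixpoint sum_bits j (F : seq bool -> R) : R :=
  if j is j'.+1 then
    sum_bits j' (fun t => F (false :: t)) + sum_bits j' (fun t => F (true :: t))
  else F [::].

(* A state is the list of the bits carried by the edges crossing a cut of the lattice; its length
   changes from cut to cut.  [op k i j M] replaces the [i] bits from position [k] on by [j] new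
   bits, with transfer matrix [M]. *)
Definition op0 i j M f s : R :=
  if (size s < i)%N then 0 else sum_bits j (fun t => M (take i s) t * f (t ++ drop i s)).

Fixpoint op k i j M f s : R :=
  if k is k'.+1 then
    (if s is x :: s' then op k' i j M (fun t => f (x :: t)) s' else 0)
  else op0 i j M f s.

Lemma eq_sum_bits j F G : (forall t, size t = j -> F t = G t) -> sum_bits j F = sum_bits j G.
Proof.
elim: j F G => [|j IHj] F G eqFG /=; first exact: eqFG.
by congr (_ + _); apply: IHj => t st; apply: eqFG => /=; rewrite st.
Qed.

Lemma sum_bitsD j F G : sum_bits j F + sum_bits j G = sum_bits j (fun t => F t + G t).
Proof. by elim: j F G => //= j IHj F G; rewrite -!IHj addrACA. Qed.

Lemma sum_bitsM j a F : a * sum_bits j F = sum_bits j (fun t => a * F t).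
Proof. by elim: j F => //= j IHj F; rewrite mulrDr !IHj. Qed.

Lemma sum_bits0 j : sum_bits j (fun=> 0) = 0.
Proof. by elim: j => //= j ->; rewrite addr0. Qed.

Lemma exchange_sum_bits i j F :
  sum_bits i (fun t => sum_bits j (F t)) = sum_bits j (fun u => sum_bits i (F^~ u)).
Proof. by elim: i F => //= i IHi F; rewrite !IHi sum_bitsD. Qed.

Lemma op_linear k i j M l (c : seq bool -> R) (g : seq bool -> seq bool -> R) s :
  op k i j M (fun r => sum_bits l (fun t => c t * g t r)) s
  = sum_bits l (fun t => c t * op k i j M (g t) s).
Proof.
elim: k s g => [|k IHk] [|x s] g /=; rewrite ?IHk //.
- rewrite /op0 /=; case: ifP => _.
    by rewrite -[LHS](sum_bits0 l); apply: eq_sum_bits => t _; rewrite mulr0.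
  under eq_sum_bits do rewrite sum_bitsM.
  rewrite exchange_sum_bits; apply: eq_sum_bits => t _.
  by rewrite sum_bitsM; apply: eq_sum_bits => u _; rewrite mulrCA.
- rewrite /op0 /=; case: ifP => _.
    by rewrite -[LHS](sum_bits0 l); apply: eq_sum_bits => t _; rewrite mulr0.
  under eq_sum_bits do rewrite sum_bitsM.
  rewrite exchange_sum_bits; apply: eq_sum_bits => t _.
  by rewrite sum_bitsM; apply: eq_sum_bits => u _; rewrite mulrCA.
- by rewrite -[LHS](sum_bits0 l); apply: eq_sum_bits => t _; rewrite mulr0.
Qed.

Lemma op_cat m i j M f t s :
  op (size t + m)%N i j M f (t ++ s) = op m i j M (fun r => f (t ++ r)) s.
Proof. by elim: t f => //= x t IHt f; rewrite IHt. Qed.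

Lemma op_short k i j M f s : (size s < k + i)%N -> op k i j M f s = 0.
Proof.
elim: k f s => [|k IHk] f s lts; first by rewrite /= /op0 lts.
by case: s lts => //= x s lts; apply: IHk; rewrite addSn ltnS in lts.
Qed.

(** Operators act on functions of the state, so a nested expression transforms the state from the
    outside in. The two operators touch disjoint blocks of bits; only the position of the right
    block changes, since the left one replaces [i] bits by [j]. *)
Lemma op_comm k m i j M i' j' M' f :
  op k i j M (op (k + (j + m))%N i' j' M' f) = op (k + (i + m))%N i' j' M' (op k i j M f).
Proof.
apply: functional_extensionality.
elim: k f => [|k IHk] f s; last by case: s => //= x s; apply: IHk.
rewrite !add0n /= {1}/op0; case: ltnP => szi.
  by rewrite op_short // (leq_trans szi) // -addnA leq_addr.
have szp : size (take i s) = i by rewrite size_takel.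
set p := take i s in szp *; set q := drop i s.
rewrite -[s in RHS](cat_take_drop i s) -/p -/q -{1}szp op_cat.
transitivity (op m i' j' M' (fun r => sum_bits j (fun t => M p t * f (t ++ r))) q).
  rewrite (op_linear _ _ _ _ _ (M p) (fun t r => f (t ++ r))).
  by apply: eq_sum_bits => t st; rewrite -st op_cat.
congr op; apply: functional_extensionality => r; rewrite /op0 size_cat szp ltnNge leq_addr /=.
by rewrite take_size_cat // drop_size_cat.
Qed.

End LocalOperators.

Section SixVertex.

Local Open Scope ring_scope.
Variables (R : comNzRingType) (Q T : R).
Implicit Types (f g : seq bool -> R) (s t : seq bool) (x y z : R).

(* [h, v] are the partial sums of the row and of the column before the entry [h' - h = v' - v], and
   [v', h'] those after it, so that the entry is 1 in the case [0, 0, 1, 1] and -1 in the case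
   [1, 1, 0, 0].  [z] is the product of the row and column parameters. *)
Definition weight z (h v v' h' : bool) : R :=
  match h, v, v', h' with
  | false, false, false, false | true, true, true, true => Q ^+ 2 * z - 1
  | false, true, true, false | true, false, false, true => Q * (1 - z)
  | false, false, true, true => Q ^+ 2 - 1
  | true, true, false, false => (Q ^+ 2 - 1) * z
  | _, _, _, _ => 0
  end.

Notation "s `_ i" := (nth false s i).

(** The row bit stands to the left of the column bit before the vertex and to its right after it, so
    a row travels through the state from left to right. *)
Definition vertex z k f := op k 2 2 (fun p t => weight z p`_0 p`_1 t`_0 t`_1) f.
(** R-matrices for two adjacent rows or columns, [z] being the ratio of their parameters: the vertex
    weights with the four edges permuted so that the number of true bits is conserved. *)
Definition row_cross z k f := op k 2 2 (fun p t => weight z p`_1 t`_1 p`_0 t`_0) f.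
Definition col_cross z k f := op k 2 2 (fun p t => weight z p`_0 t`_0 p`_1 t`_1) f.

(* At a reflecting wall a column turns into a row on the left, and a row into a column on the
   right.  The weight of a diagonal entry 1 is not zero for general parameters, but it vanishes at
   [x = T]. *)
Definition left_weight x (v h : bool) : R :=
  match v, h with
  | false, false => Q ^+ 2 * x ^+ 2 - 1
  | true, false => x * (Q ^+ 2 * (T * x) - 1)
  | false, true => Q * (T - x)
  | true, true => 0
  end.

Definition right_weight x (h v : bool) : R :=
  match h, v with
  | true, false => Q * (1 - x ^+ 2)
  | true, true => x * (Q * (1 - T * x))
  | false, false => Q * (x - T)
  | false, true => 0
  end.

Definition turn_left x f := op 0 1 1 (fun p t => left_weight x p`_0 t`_0) f.
Definition turn_right x k f := op k 2 0 (fun p _ => right_weight x p`_0 p`_1) f.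

Definition cup k f := op k 0 2 (fun _ t => (t`_0 == t`_1)%:R) f.

Ltac local_identity :=
  rewrite /row_cross /col_cross /vertex /turn_left /turn_right /cup /= /op0 /= ?(mulr0, addr0) //;
  rewrite ?(mul0r, mul1r, add0r, addr0, mulr0) ?drop0; ring.

(** [k] only shifts the position. At [k = 0] each value of the three bits gives a ring identity in
    the values of the arbitrary [f]. *)
Lemma row_yang_baxter z x k f :
  row_cross z k (vertex x k.+1 (vertex (z * x) k f))
  = vertex (z * x) k.+1 (vertex x k (row_cross z k.+1 f)).
Proof.
elim: k f => [|k IHk] f; apply: functional_extensionality => s; last first.
  by case: s => [//|b s]; apply: (equal_f (IHk (fun t => f (b :: t))) s).
case: s => [|a [|b [|c s]]]; last by case: a b c => [] [] []; local_identity.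
all: by rewrite /row_cross /vertex /= /op0 /= ?(mulr0, addr0).
Qed.

Lemma col_yang_baxter z x k f :
  col_cross z k.+1 (vertex x k (vertex (z * x) k.+1 f))
  = vertex (z * x) k (vertex x k.+1 (col_cross z k f)).
Proof.
elim: k f => [|k IHk] f; apply: functional_extensionality => s; last first.
  by case: s => [//|b s]; apply: (equal_f (IHk (fun t => f (b :: t))) s).
case: s => [|a [|b [|c s]]]; last by case: a b c => [] [] []; local_identity.
all: by rewrite /col_cross /vertex /= /op0 /= ?(mulr0, addr0).
Qed.

Definition bounce_left x y f := turn_left x (vertex (x * y) 0 (turn_left y f)).

Definition bounce_right x y k f :=
  vertex (x * y) k.+1 (turn_right x k.+2 (turn_right y k f)).

(** Reflection equation: the wall turns columns into rows, so a column crossing that reaches it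
    reappears as a row crossing. *)
Lemma left_reflection z y f :
  col_cross z 0 (bounce_left y (z * y) f) = bounce_left (z * y) y (row_cross z 0 f).
Proof.
apply: functional_extensionality => s; rewrite /bounce_left.
case: s => [|a [|b s]]; last by case: a b => [] []; local_identity.
all: by rewrite /col_cross /row_cross /vertex /turn_left /= /op0 /= ?(mulr0, addr0).
Qed.

Lemma right_reflection z y k f :
  row_cross z k (bounce_right y (z * y) k f) = col_cross z k.+2 (bounce_right (z * y) y k f).
Proof.
rewrite /bounce_right.
elim: k f => [|k IHk] f; apply: functional_extensionality => s; last first.
  by case: s => [//|b s]; apply: (equal_f (IHk (fun t => f (b :: t))) s).
case: s => [|a [|b [|c [|d s]]]]; last by case: a b c d => [] [] [] []; local_identity.
all: by rewrite /col_cross /row_cross /vertex /turn_right /= /op0 /= ?(mulr0, addr0).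
Qed.

(** Sliding the cup rotates the vertex, and [row_cross] is exactly the vertex weight with its edges
    rotated in this way. *)
Lemma cup_vertex z k f : cup k.+1 (vertex z k f) = cup k (row_cross z k.+1 f).
Proof.
elim: k f => [|k IHk] f; apply: functional_extensionality => s; last first.
  by case: s => [//|b s]; apply: (equal_f (IHk (fun t => f (b :: t))) s).
case: s => [|a s]; last by case: a; local_identity.
by rewrite /cup /row_cross /vertex /= /op0 /= ?(mulr0, addr0).
Qed.

Definition flip k f := op k 1 1 (fun p t => (if p`_0 then 1 else Q) * (t`_0 != p`_0)%:R) f.

(** Crossing symmetry: once the column bit is negated, with relative weight [Q], the vertex acts as
    a crossing of two rows. *)
Lemma flip_vertex z y k f : Q ^+ 2 * (z * y) = 1 ->
  flip k.+1 (vertex y k f) = fun s => Q * y * row_cross z k (flip k f) s.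
Proof.
move=> zyE; elim: k f => [|k IHk] f; apply: functional_extensionality => s; last first.
  by case: s => [|b s] /=; rewrite ?mulr0 //; apply: (equal_f (IHk (fun t => f (b :: t))) s).
case: s => [|a [|b s]]; rewrite /flip /row_cross /vertex /= /op0 /= ?(mulr0, addr0) //.
case: a b => [] []; rewrite /= ?(mul0r, mul1r, mulr1, add0r, addr0, mulr0) ?drop0; ring: zyE.
Qed.

End SixVertex.

#[global] Arguments op : simpl never.

(** * A row crossing a list of columns *)

Section Rows.

Local Open Scope ring_scope.
Variables (R : comNzRingType) (Q T : R).
Implicit Types (f g : seq bool -> R) (s t : seq bool) (x y z : R) (ys zs us : seq R).
Implicit Types (M : seq bool -> seq bool -> R) (k l : nat).

Fixpoint line x ys k f :=
  if ys is y :: ys' then vertex Q (x * y) k (line x ys' k.+1 f) else f.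

Lemma line_cat x ys zs k f : line x (ys ++ zs) k f = line x ys k (line x zs (k + size ys) f).
Proof. by elim: ys k => [|y ys IHys] k /=; rewrite ?addn0 // IHys addSnnS. Qed.

Lemma op_comm_le k l i j M i' j' M' f : (k + j <= l)%N ->
  op k i j M (op l i' j' M' f) = op (l + i - j) i' j' M' (op k i j M f).
Proof.
move=> le_l; rewrite -{1}(subnKC le_l) -addnA op_comm; congr (op _ _ _ _ _); lia.
Qed.

Lemma line_op x ys k l i j M f : (k + size ys < l)%N ->
  line x ys k (op l i j M f) = op l i j M (line x ys k f).
Proof.
elim: ys k => [|y ys IHys] k //= lt_l; rewrite IHys; last by rewrite addSnnS.
by rewrite /vertex op_comm_le ?addnK //; lia.
Qed.

Lemma op_line x ys k l i j M f : (l + j <= k)%N ->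
  op l i j M (line x ys k f) = line x ys (k + i - j) (op l i j M f).
Proof.
elim: ys k => [|y ys IHys] k //= le_k; rewrite /vertex op_comm_le // IHys; last lia.
by congr (op _ _ _ _ (line _ _ _ _)); lia.
Qed.

Lemma line_line x ys k y zs l f : (k + size ys < l)%N ->
  line x ys k (line y zs l f) = line y zs l (line x ys k f).
Proof.
elim: zs l => [|v zs IHzs] l //= lt_l; rewrite line_op // IHzs //; lia.
Qed.

(** Train argument: the Yang-Baxter equation carries the crossing over one column after the
    other. *)
Lemma line_row_cross z y ys k f :
  row_cross Q z k (line y ys k.+1 (line (z * y) ys k f))
  = line (z * y) ys k.+1 (line y ys k (row_cross Q z (k + size ys) f)).
Proof.
elim: ys k f => [|v ys IHys] k f /=; first by rewrite addn0.
have vertex_row x u f' : line u ys k.+2 (vertex Q x k f') = vertex Q x k (line u ys k.+2 f').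
  by rewrite /vertex op_line ?addnK //; lia.
rewrite !vertex_row -[z * y * v]mulrA row_yang_baxter IHys addSnnS.
by [].
Qed.

Lemma line_col_cross x z y ys zs k f :
  col_cross Q z (k + size ys).+1 (line x (ys ++ [:: y, z * y & zs]) k f)
  = line x (ys ++ [:: z * y, y & zs]) k (col_cross Q z (k + size ys) f).
Proof.
rewrite !line_cat /= -!addSn; set l := (k + size ys)%N.
rewrite {1}/col_cross -line_op // -/(col_cross Q z l.+1 _).
rewrite [x * (z * y)]mulrCA col_yang_baxter /col_cross op_line ?addnK // /l; lia.
Qed.

Lemma line_cup x ys k l f : (l <= k)%N -> cup l (line x ys k.+2 f) = line x ys k (cup l f).
Proof. by move=> le_lk; rewrite /cup op_line ?addn0 ?subn2 //; lia. Qed.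

(** A constant factor, encoded as an operator on no bits so that [op_comm] moves it past all other
    operators. *)
Definition scale (c : R) f : seq bool -> R := op 0 0 0 (fun _ _ => c) f.

Lemma scaleE c f s : scale c f s = c * f s.
Proof. by rewrite /scale /op /op0 /= drop0. Qed.

Lemma scale_op c l i j M f : scale c (op l i j M f) = op l i j M (scale c f).
Proof. by rewrite /scale op_comm_le // addn0 subn0. Qed.

Lemma scale_line c x ys k f : scale c (line x ys k f) = line x ys k (scale c f).
Proof. by rewrite /scale op_line // addn0 subn0. Qed.

End Rows.

(** * The triangular lattice and the exchange of its lines *)

Section Triangle.

Local Open Scope ring_scope.
Variables (R : comNzRingType) (Q T : R).
Implicit Types (f : seq bool -> R) (g : bool -> R) (s t : seq bool).
Implicit Types (w x y z u : R) (ys zs us : seq R) (k l : nat).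

(* The first element of [us] is the outermost line: the wall turns its left column into the top
   row and this row into its right column.  [g] weights the bit leaving the central column. *)
Fixpoint triangle w g us : seq bool -> R :=
  if us is u :: us' then
    turn_left Q T u (line Q u (us' ++ w :: rev us') 0
      (turn_right Q T u (size us').*2.+1 (triangle w g us')))
  else fun s => if s is [:: m] then g m else 0.

Lemma turn_left_op x l i j (M : seq bool -> seq bool -> R) f : (0 < l)%N ->
  turn_left Q T x (op l i j M f) = op l i j M (turn_left Q T x f).
Proof. by move=> lt0l; rewrite /turn_left op_comm_le // addnK. Qed.

Lemma turn_left_line x y ys k f : (0 < k)%N ->
  turn_left Q T x (line Q y ys k f) = line Q y ys k (turn_left Q T x f).
Proof. by move=> lt0k; rewrite /turn_left op_line // addnK. Qed.

Lemma bounce_left_op x y l i j (M : seq bool -> seq bool -> R) f : (1 < l)%N ->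
  bounce_left Q T x y (op l i j M f) = op l i j M (bounce_left Q T x y f).
Proof.
move=> lt1l; rewrite /bounce_left turn_left_op 1?ltnW //.
by rewrite {1}/vertex op_comm_le // addnK turn_left_op // ltnW.
Qed.

(** The crossing of the two leftmost columns becomes a row crossing at the left wall, is carried
    over the inner columns by Yang-Baxter, and comes back as a column crossing at the right wall. *)
Lemma triangle_swap0 w g z y us :
  col_cross Q z 0 (triangle w g (y :: z * y :: us))
  = col_cross Q z (size us).*2.+3 (triangle w g (z * y :: y :: us)).
Proof.
(* Commuting independent operators puts both left walls first, then the two rows through the inner
   columns, and both right walls last. *)
have expand u v : triangle w g (u :: v :: us) = bounce_left Q T u v
    (line Q u (us ++ w :: rev us) 1 (line Q v (us ++ w :: rev us) 0
      (bounce_right Q T u v (size us).*2.+1 (triangle w g us)))).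
  rewrite /bounce_left /bounce_right /= rev_cons -cats1 -cat_cons catA line_cat /=.
  have -> : (1 + size (us ++ w :: rev us))%N = (size us).*2.+2.
    by rewrite size_cat /= size_rev; lia.
  congr (turn_left _ _ _ (vertex _ _ _ _)).
  have sz : size (us ++ w :: rev us) = (size us).*2.+1 by rewrite size_cat /= size_rev; lia.
  rewrite [RHS]turn_left_line //; congr (line _ _ _ _ _).
  rewrite /turn_right /vertex; do 2![rewrite [in RHS]line_op ?sz ?doubleS ?add0n //].
  by do 2![rewrite [in RHS]turn_left_op //].
have sz : size (us ++ w :: rev us) = (size us).*2.+1 by rewrite size_cat /= size_rev; lia.
rewrite !expand left_reflection line_row_cross sz right_reflection /col_cross.
by do 2![rewrite line_op ?sz //]; rewrite bounce_left_op.
Qed.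

Lemma turn_right_col_cross z x k l f : (l + 2 <= k)%N ->
  turn_right Q T x k (col_cross Q z l f) = col_cross Q z l (turn_right Q T x k f).
Proof. by move=> le_lk; rewrite /turn_right /col_cross [RHS]op_comm_le // addnK. Qed.

(** The rows of the outer lines [ps] cross both columns of the pair: column Yang-Baxter carries the
    crossing down over them on the left, and the crossing that results back up on the right. *)
Lemma triangle_swap w g z y ps us :
  col_cross Q z (size ps) (triangle w g (ps ++ [:: y, z * y & us]))
  = col_cross Q z (size ps + (size us).*2.+3) (triangle w g (ps ++ [:: z * y, y & us])).
Proof.
elim: ps => [|u ps IHps] /=; first by rewrite triangle_swap0.
have split_list a b : (ps ++ [:: a, b & us]) ++ w :: rev (ps ++ [:: a, b & us])
    = ps ++ [:: a, b & us ++ w :: rev us ++ [:: b, a & rev ps]].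
  by rewrite rev_cat !rev_cons -!cats1 -!catA.
rewrite {1}/col_cross -turn_left_op // -/(col_cross _ _ _ _) split_list.
rewrite -[size ps]add0n line_col_cross add0n -turn_right_col_cross; last first.
  by rewrite size_cat /=; lia.
rewrite IHps turn_right_col_cross; last by rewrite size_cat /=; lia.
rewrite [RHS]/col_cross -turn_left_op; last lia.
rewrite -/(col_cross _ _ _ _) split_list; congr (turn_left _ _ _ _).
set ys := ps ++ [:: z * y, y & us ++ w :: rev us].
have ysE a b : ps ++ [:: z * y, y & us ++ w :: rev us ++ [:: a, b & rev ps]]
    = ys ++ [:: a, b & rev ps] by rewrite /ys -!catA /= -!catA.
have sz : (size ps + (size us).*2.+3 = 0 + size ys)%N.
  by rewrite /ys !size_cat /= size_cat /= size_rev; lia.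
by rewrite !ysE sz -line_col_cross -sz !size_cat.
Qed.

End Triangle.

(** * Pushing a line through the triangle *)

Section Push.

Local Open Scope ring_scope.
Variables (F : fieldType) (Q T : F).
Implicit Types (f : seq bool -> F) (g : bool -> F) (s t : seq bool).
Implicit Types (w x y z u : F) (ys zs us : seq F) (k l : nat).

Fixpoint move_left u ys k f :=
  if ys is y :: ys' then move_left u ys' k.+1 (col_cross Q (y / u) k f) else f.

Lemma line_move_left x u ps ys qs f : u != 0 ->
  line Q x (ps ++ ys ++ u :: qs) 0 (move_left u ys (size ps) f)
  = move_left u ys (size ps).+1 (line Q x (ps ++ u :: ys ++ qs) 0 f).
Proof.
move=> u0; elim: ys ps f => [|y ys IHys] ps f //=.
have -> : (size ps).+1 = size (rcons ps y) by rewrite size_rcons.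
rewrite -cat_rcons IHys size_rcons; congr (move_left _ _ _ _).
by rewrite cat_rcons -{1}(divfK u0 y) -[size ps]add0n -line_col_cross divfK.
Qed.

Lemma move_left_op u ys k l i j (M : seq bool -> seq bool -> F) f : (k + size ys < l)%N ->
  move_left u ys k (op l i j M f) = op l i j M (move_left u ys k f).
Proof.
elim: ys k f => [|y ys IHys] k f //= lt_l; rewrite /col_cross op_comm_le; last lia.
by rewrite addnK IHys //; lia.
Qed.

Lemma turn_left_move_left x u ys k f : (0 < k)%N ->
  turn_left Q T x (move_left u ys k f) = move_left u ys k (turn_left Q T x f).
Proof. by elim: ys k f => [|y ys IHys] k f //= lt0k; rewrite IHys // /col_cross turn_left_op. Qed.

Lemma move_left_cat u ys zs k f :
  move_left u (ys ++ zs) k f = move_left u zs (k + size ys) (move_left u ys k f).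
Proof. by elim: ys k f => [|y ys IHys] k f /=; rewrite ?addn0 // IHys addSnnS. Qed.

End Push.

Section Push.

Local Open Scope ring_scope.
Variables (F : fieldType) (Q T : F).
Implicit Types (f : seq bool -> F) (g : bool -> F) (s t : seq bool).
Implicit Types (w x y z u : F) (ys zs us : seq F) (k l : nat).

Lemma cup_op k l i j (M : seq bool -> seq bool -> F) f : (k <= l)%N ->
  cup k (op l.+2 i j M f) = op l i j M (cup k f).
Proof. by move=> le_kl; rewrite /cup op_comm_le ?addn0 ?subn2 //; lia. Qed.

Lemma vertex_vertex z k y l f : (k + 2 <= l)%N ->
  vertex Q z k (vertex Q y l f) = vertex Q y l (vertex Q z k f).
Proof. by move=> le_kl; rewrite {1}/vertex op_comm_le // addnK. Qed.

Lemma turn_right_vertex x k z l f : (l + 2 <= k)%N ->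
  turn_right Q T x k (vertex Q z l f) = vertex Q z l (turn_right Q T x k f).
Proof. by move=> le_lk; rewrite {2}/vertex op_comm_le // addnK. Qed.

Lemma line_vertex x ys k z l f : (k + size ys < l)%N ->
  line Q x ys k (vertex Q z l f) = vertex Q z l (line Q x ys k f).
Proof. by move=> lt_l; rewrite {1}/vertex line_op. Qed.

Lemma vertex_line x ys k z l f : (l + 2 <= k)%N ->
  line Q x ys k (vertex Q z l f) = vertex Q z l (line Q x ys k f).
Proof. by move=> le_lk; rewrite {2}/vertex op_line // addnK. Qed.

Lemma line_turn_right x ys k y l f : (k + size ys < l)%N ->
  line Q x ys k (turn_right Q T y l f) = turn_right Q T y l (line Q x ys k f).
Proof. by move=> lt_l; rewrite {1}/turn_right line_op. Qed.

Lemma push_right_step x u ys f : u != 0 -> let n := size ys in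
  cup n.+1 (line Q u ys n.+2 (vertex Q (u * x) n.*2.+2 (turn_right Q T u n.*2.+3
    (vertex Q (x / u) n (line Q x ys n.+1 (turn_right Q T x n.*2.+1 f))))))
  = col_cross Q (x / u) n.*2.+1 (line Q x (ys ++ [:: u]) n (turn_right Q T x n.*2.+1
      (cup n (line Q u ys n.+1 (turn_right Q T u n.*2.+1 f))))).
Proof.
move=> u0 n.
rewrite turn_right_vertex; last lia.
rewrite -vertex_vertex; last lia.
rewrite vertex_line; last lia.
rewrite cup_vertex.
rewrite -line_turn_right -/n; last lia.
rewrite -line_vertex -/n; last lia.
have -> : vertex Q (u * x) n.*2.+2 (turn_right Q T u n.*2.+3 (turn_right Q T x n.*2.+1 f))
    = bounce_right Q T u (x / u * u) n.*2.+1 f by rewrite divfK.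
rewrite -{2}(divfK u0 x) line_row_cross -/n.
have -> : (n.+1 + n = n.*2.+1)%N by lia.
rewrite right_reflection divfK // /bounce_right.
rewrite /col_cross line_op -/n; last lia.
rewrite line_vertex -/n; last lia.
rewrite [line _ _ _ _ (turn_right _ _ _ n.*2.+3 _)]line_turn_right -/n; last lia.
rewrite line_cup //.
rewrite cup_op; last lia.
rewrite line_op -/n; last lia.
congr (op _ _ _ _ _); rewrite line_cat /= -/n.
congr (line _ _ _ _ _); rewrite addnn.
rewrite {1}/vertex cup_op; last lia.
congr (op _ _ _ _ _); rewrite {1}/turn_right cup_op //; lia.
Qed.

Lemma push_right u g us : u != 0 ->
  cup (size us) (line Q u (rev us) (size us).+1
    (turn_right Q T u (size us).*2.+1 (triangle Q T u^-1 g us)))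
  = move_left Q u (rev us) (size us)
      (triangle Q T u (fun v => \sum_m g m * right_weight Q T u m v) us).
Proof.
move=> u0; elim: us => [|x us IHus] /=.
  apply: functional_extensionality; case=> [|v [|v' s]];
    rewrite /cup /turn_right /op /= /op0 /= ?mulr0 ?addr0 //.
  by rewrite big_bool; case: v => /=; ring.
rewrite rev_cons -cats1 !line_cat /= size_rev !add0n.
set n := size us in IHus *.
have -> : (n.+1.*2.+1 = n.*2.+3)%N by lia.
have -> : (n.+2 + n = n.*2.+2)%N by lia.
(* The part of the line [x] to the left of the centre commutes with every operator that acts to the
   right of it. *)
pose A f := turn_left Q T x (line Q x us 0 f).
have A_op l i j (M : seq bool -> seq bool -> F) f : (n < l)%N -> A (op l i j M f) = op l i j M (A f).
  by move=> ltnl; rewrite /A line_op // turn_left_op //; lia.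
have A_line y ys l f : (n < l)%N -> A (line Q y ys l f) = line Q y ys l (A f).
  by move=> ltnl; rewrite /A line_line // turn_left_line //; lia.
rewrite -/(A _) {1}/cup {1}/vertex {1}/turn_right -!A_op; try lia.
rewrite -A_line; last lia.
rewrite -A_op; last lia.
have := push_right_step x (rev us) (triangle Q T u^-1 g us) u0.
rewrite size_rev -/n /cup /vertex /turn_right => ->; rewrite -/(turn_right Q T _ _ _).
rewrite -/(cup _ _) -/(turn_right Q T _ _ _) IHus.
rewrite {1}/col_cross A_op; last lia.
rewrite move_left_cat size_rev -/n /=.
have -> : (n.+1 + n = n.*2.+1)%N by lia.
rewrite /col_cross; congr (op _ _ _ _ _); rewrite /A -[n in line _ _ _ n]add0n -line_cat.
rewrite {1}/turn_right -move_left_op ?size_rev -/n; last lia.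
rewrite line_move_left // turn_left_move_left // cats0 line_cat /= add0n.
by [].
Qed.
End Push.

Section PushLeft.

Local Open Scope ring_scope.
Variables (F : fieldType) (Q T : F).
Implicit Types (f : seq bool -> F) (g : bool -> F) (s t : seq bool).
Implicit Types (c w x y z u : F) (ys zs us : seq F) (k l : nat).

Lemma scale_bounce_left c x y f :
  scale c (bounce_left Q T x y f) = bounce_left Q T x y (scale c f).
Proof. by rewrite /bounce_left /turn_left /vertex !scale_op. Qed.

Fixpoint move_right u ys k f :=
  if ys is y :: ys' then col_cross Q (u / y) k (move_right u ys' k.+1 f) else f.

Lemma line_move_right x u ps ys qs f : all (predC1 0) ys ->
  line Q x (ps ++ u :: ys ++ qs) 0 (move_right u ys (size ps) f)
  = move_right u ys (size ps).+1 (line Q x (ps ++ ys ++ u :: qs) 0 f).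
Proof.
elim: ys ps f => [|y ys IHys] ps f //= /andP[y0 ys0].
rewrite -{1}(divfK y0 u) -{2}[size ps]add0n -line_col_cross divfK // add0n.
by rewrite -cat_rcons -(size_rcons ps y) IHys // cat_rcons.
Qed.

Lemma turn_right_move_right x u ys k l f : (k + size ys < l)%N ->
  turn_right Q T x l (move_right u ys k f) = move_right u ys k (turn_right Q T x l f).
Proof.
elim: ys k => [|y ys IHys] k //= lt_l; rewrite turn_right_col_cross ?IHys //; lia.
Qed.

Lemma turn_left_move_right x u ys k f : (0 < k)%N ->
  turn_left Q T x (move_right u ys k f) = move_right u ys k (turn_left Q T x f).
Proof. by elim: ys k f => [|y ys IHys] k f //= lt0k; rewrite /col_cross turn_left_op // IHys. Qed.

(** Counterpart of [push_right_step]: [flip] bends the line [u] into the central column, crossing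
    symmetry turns the vertex of [x] with that column into a row crossing at the cost of
    [Q * (x * w)], and left reflection makes it a column crossing. *)
Lemma push_left_step x u w us zs k f : let n := size us in
    Q ^+ 2 * (u * w) = 1 -> x != 0 -> (n < k)%N ->
  turn_left Q T u (line Q u (x :: us) 0 (flip Q n.+1 (turn_left Q T x
    (line Q x (us ++ w :: zs) 0 (turn_right Q T x k f)))))
  = scale (Q * (x * w)) (col_cross Q (u / x) 0 (turn_left Q T x
      (line Q x (u :: us ++ zs) 0 (turn_right Q T x k
        (turn_left Q T u (line Q u us 0 (flip Q n f))))))).
Proof.
move=> n uw x0 ltnk /=.
rewrite line_cat /= -/n add0n.
rewrite {1}/flip -turn_left_op // -/(flip _ _ _) -turn_left_line //.
rewrite -/(bounce_left Q T u x _).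
rewrite {1}/flip -line_op // -/(flip _ _ _).
have -> h : flip Q n.+1 (vertex Q (x * w) n h) = scale (Q * (x * w)) (row_cross Q (u / x) n (flip Q n h)).
  have zw : Q ^+ 2 * (u / x * (x * w)) = 1 by rewrite [_ / _ * _]mulrA divfK.
  rewrite (flip_vertex _ _ zw).
  by apply: functional_extensionality => s; rewrite scaleE.
have := line_row_cross Q (u / x) x us 0; rewrite add0n divfK // => /(_ _)/esym rowE.
rewrite -!scale_line rowE -scale_bounce_left; congr (scale _ _).
have := left_reflection Q T (u / x) x; rewrite divfK // => /(_ _)/esym ->.
congr (col_cross _ _ _ _); rewrite /bounce_left; congr (turn_left _ _ _ _).
rewrite line_cat add1n -/n; congr (vertex _ _ _ _).
rewrite {1}/flip op_line /= -/n ?addn1 // subn1 /=.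
rewrite [line _ u _ _ _]line_line ?add0n //.
rewrite turn_left_line // turn_left_line //; congr (line _ _ _ _ (line _ _ _ _ _)).
rewrite -/(flip _ _ _) {1}/flip op_comm_le ?addn1 // subn1 /=.
by rewrite line_op ?add0n // turn_left_op //; lia.
Qed.

(** Here the line [u] comes from the left wall and continues, negated, as the central column. After
    the push the new centre ends in the left wall, and the negation appears as [~~ m]. *)
Lemma push_left u w g us : Q ^+ 2 * (u * w) = 1 -> all (predC1 0) us ->
  turn_left Q T u (line Q u us 0 (flip Q (size us) (triangle Q T w g us)))
  = scale (\prod_(x <- us) (Q * (x * w))) (move_right u us 0
      (triangle Q T u (fun v => \sum_m g m * ((if m then Q else 1) * left_weight Q T u v (~~ m))) us)).
Proof.
move=> uw; elim: us => [_|x us IHus /andP[x0 us0]].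
  apply: functional_extensionality => s; rewrite scaleE big_nil mul1r /=.
  case: s => [|v [|v' s]]; rewrite /flip /turn_left /op /= /op0 /= ?(mulr0, addr0) //.
  by rewrite big_bool; case: v => /=; ring.
rewrite [triangle Q T w g _]/= [size (x :: us)]/= push_left_step //; last by lia.
rewrite IHus // big_cons.
rewrite {1}/turn_right -scale_op -scale_line {1}/turn_left -scale_op {1}/col_cross -scale_op.
rewrite -/(turn_right _ _ _ _ _) -/(turn_left _ _ _ _) -/(col_cross _ _ _ _).
apply: functional_extensionality => s; rewrite !scaleE mulrA; congr (_ * _).
rewrite turn_right_move_right; last lia.
have := line_move_right x u [::] (rev us) (turn_right Q T x (size us).*2.+1 (triangle Q T u
  (fun v => \sum_m g m * ((if m then Q else 1) * left_weight Q T u v (~~ m))) us)) us0.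
by rewrite /= => ->; rewrite turn_left_move_right.
Qed.
End PushLeft.

(** * Frozen boundaries and the square lattice *)

Section Vacuum.

Local Open Scope ring_scope.
Variables (R : comNzRingType) (Q T : R).
Implicit Types (f g : seq bool -> R) (s t p r : seq bool).
Implicit Types (c w x y z u : R) (ys zs us : seq R) (k l n : nat).

Notation vac n := (nseq n false).

Lemma vertexE z f h v s :
  vertex Q z 0 f [:: h, v & s]
  = sum_bits 2 (fun t => weight Q z h v (nth false t 0) (nth false t 1) * f (t ++ s)).
Proof. by rewrite /vertex /op /op0 /= drop0. Qed.

Lemma line_cons x ys k f b s : line Q x ys k.+1 f (b :: s) = line Q x ys k (fun t => f (b :: t)) s.
Proof.
elim: ys k f s => //= y ys IHys k f s.
rewrite -[LHS]/(vertex Q (x * y) k (fun t => line Q x ys k.+2 f (b :: t)) s).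
congr (vertex _ _ _ _ _); apply: functional_extensionality => t; exact: IHys.
Qed.

(** Among false columns a true row bit admits only zero entries: the row is frozen. *)
Lemma line_true_vac x ys f r :
  line Q x ys 0 f (true :: vac (size ys) ++ r)
  = (\prod_(y <- ys) (Q * (1 - x * y))) * f (vac (size ys) ++ true :: r).
Proof.
elim: ys f => [|y ys IHys] f; first by rewrite big_nil mul1r.
rewrite big_cons /= vertexE /= !mul0r !add0r ?addr0 line_cons IHys.
by rewrite mulrA.
Qed.

(** A first entry 1 would leave the row bit true for good, which the hypothesis on [f] excludes; so
    all entries are 0. *)
Lemma line_vac x ys f r : (forall p, size p = size ys -> f (p ++ true :: r) = 0) ->
  line Q x ys 0 f (false :: vac (size ys) ++ r)
  = (\prod_(y <- ys) (Q ^+ 2 * (x * y) - 1)) * f (vac (size ys) ++ false :: r).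
Proof.
elim: ys f => [|y ys IHys] f f0; first by rewrite big_nil mul1r.
rewrite big_cons /= vertexE /= !mul0r !add0r ?addr0 !line_cons line_true_vac.
rewrite /= (f0 (true :: vac (size ys))) /= ?size_nseq // !mulr0 addr0 IHys ?mulrA //.
by move=> p sp; apply: (f0 (false :: p)); rewrite /= sp.
Qed.

Lemma line_ext x ys f g h s r r' : size s = size ys ->
    (forall p b, size p = size ys -> f (p ++ b :: r) = g (p ++ b :: r')) ->
  line Q x ys 0 f (h :: s ++ r) = line Q x ys 0 g (h :: s ++ r').
Proof.
elim: ys f g h s => [|y ys IHys] f g h [|v s] //= => [_ fg | [ss] fg].
  exact: (fg [::]).
rewrite !vertexE; apply: eq_sum_bits => -[|a [|b [|? ?]]] //= _.
rewrite !line_cons; congr (_ * _); apply: IHys => // p c sp.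
by apply: (fg (a :: p)); rewrite /= sp.
Qed.

Lemma col_cross_vac z k n f : (k + 2 <= n)%N ->
  col_cross Q z k f (vac n) = (Q ^+ 2 * z - 1) * f (vac n).
Proof.
elim: k n f => [|k IHk] [|n] f //; last first.
  by rewrite addSn ltnS => lek; exact: (IHk n (fun t => f (false :: t))).
case: n => [|n] // _; rewrite /col_cross /op /op0 /= drop0 !mul0r !addr0.
by [].
Qed.

End Vacuum.

Section Freezing.

Local Open Scope ring_scope.
Variables (F : fieldType) (Q T : F).
Implicit Types (f g : seq bool -> F) (s t p r : seq bool).
Implicit Types (c w x y z u : F) (ys zs us : seq F) (k l n : nat).

Notation vac n := (nseq n false).

Definition is_one : bool -> F := fun m => m%:R.
Definition is_zero : bool -> F := fun m => (~~ m)%:R.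

Lemma op_combination k i j M a b f g h s : (forall r, h r = a * f r + b * g r) ->
  op k i j M h s = a * op k i j M f s + b * op k i j M g s.
Proof.
(* The two terms are encoded as a sum over one bit, to which [op_linear] applies. *)
move=> hE; pose coef t := if nth false t 0 then b else a.
pose fg t := if nth false t 0 then g else f.
have -> : h = fun r => sum_bits 1 (fun t => coef t * fg t r).
  by apply: functional_extensionality => r; rewrite hE.
by rewrite op_linear.
Qed.

Lemma line_combination x ys k a b f g h s : (forall r, h r = a * f r + b * g r) ->
  line Q x ys k h s = a * line Q x ys k f s + b * line Q x ys k g s.
Proof.
move=> hE; elim: ys k s => [|y ys IHys] k s //=.
by apply: op_combination => r; apply: IHys.
Qed.

Lemma triangle_linear w (g : bool -> F) us s :
  triangle Q T w g us s
  = g false * triangle Q T w is_zero us s + g true * triangle Q T w is_one us s.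
Proof.
elim: us s => [|u us IHus] s /=.
  case: s => [|m [|b s]]; rewrite ?mulr0 ?addr0 //.
  by rewrite /is_zero /is_one; case: m; rewrite /= !mulr1 !mulr0 ?addr0 ?add0r.
apply: op_combination => r1; apply: line_combination => r2.
by apply: op_combination => r3; apply: IHus.
Qed.

(** At parameter [T] the left wall emits only false and the right wall accepts only true, so the
    innermost row raises the central bit from false to true. *)
Lemma triangle_zero w us : triangle Q T w is_zero (us ++ [:: T]) = fun=> 0.
Proof.
elim: us => [|u us IHus]; apply: functional_extensionality => s.
  rewrite /=; case: s => [|a [|b [|c [|d s]]]];
    rewrite /turn_left /vertex /turn_right /op /= /op0 /= ?(mulr0, addr0) //.
  by case: a b c => [] [] []; rewrite /= /is_zero /=; ring.
rewrite /= IHus.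
have op_0 k i j M : op k i j M (fun=> 0) = (fun=> 0 : F).
  apply: functional_extensionality => s'.
  rewrite (@op_combination k i j M 0 0 (fun=> 0) (fun=> 0)) ?mul0r ?addr0 //.
have line_0 x ys k : line Q x ys k (fun=> 0) = (fun=> 0 : F).
  by elim: ys k => //= y ys IHys k; rewrite /vertex IHys op_0.
by rewrite /turn_right /turn_left op_0 line_0 op_0.
Qed.

Lemma move_left_vac u ys k n f : (k + size ys < n)%N ->
  move_left Q u ys k f (vac n) = (\prod_(y <- ys) (Q ^+ 2 * (y / u) - 1)) * f (vac n).
Proof.
elim: ys k f => [|y ys IHys] k f lt_n; first by rewrite big_nil mul1r.
rewrite /= in lt_n; rewrite /= IHys; last lia.
by rewrite col_cross_vac ?big_cons ?mulrA 1?[in RHS](mulrC (_ - 1)) //; lia.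
Qed.

Lemma move_right_vac u ys k n f : (k + size ys < n)%N ->
  move_right Q u ys k f (vac n) = (\prod_(y <- ys) (Q ^+ 2 * (u / y) - 1)) * f (vac n).
Proof.
elim: ys k f => [|y ys IHys] k f lt_n; first by rewrite big_nil mul1r.
rewrite /= in lt_n; rewrite /= col_cross_vac; last lia.
by rewrite IHys ?big_cons ?mulrA //; lia.
Qed.

Lemma line_pass x ys p k f s :
  line Q x ys (size p + k) f (p ++ s) = line Q x ys k (fun t => f (p ++ t)) s.
Proof. by elim: p f => //= b p IHp f; rewrite line_cons IHp. Qed.

(** The vertex of the first row with the centre has parameter 1 and factors into the conditions
    [h = v] and [v' = h']. So the row is frozen to the left of the centre and starts from a cup to
    the right of it, where [push_right] applies. By [triangle_zero] the new centre must end with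
    true. *)
Lemma triangle_freeze_right u us : u != 0 ->
  triangle Q T u^-1 is_one (u :: us ++ [:: T]) (vac (size us).+2.*2.+1)
  = (Q ^+ 2 * u ^+ 2 - 1) * (\prod_(y <- us ++ [:: T]) (Q ^+ 2 * (u * y) - 1)) * (Q ^+ 2 - 1)
    * (\prod_(y <- us ++ [:: T]) (Q ^+ 2 * (y / u) - 1)) * (u * (Q * (1 - T * u)))
    * triangle Q T u is_one (us ++ [:: T]) (vac (size us).+1.*2.+1).
Proof.
move=> u0; pose vs := us ++ [:: T]; rewrite -/vs.
pose k := size vs; have kE : k = (size us).+1 by rewrite /k size_cat addn1.
rewrite -kE.
pose H := line Q u (rev vs) k.+1 (turn_right Q T u k.*2.+1 (triangle Q T u^-1 is_one vs)).
pose G := vertex Q (u * u^-1) k H.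
have G0 p r : size p = k -> G (p ++ true :: false :: r) = 0.
  move=> sp; rewrite /G /vertex -[k]addn0 -sp op_cat -/(vertex _ _ _ _) vertexE /= mulfV //.
  by rewrite subrr; ring.
have -> : vac k.+1.*2.+1 = false :: vac k ++ false :: vac k.+1.
  by rewrite -[RHS]/(vac 1 ++ (vac k ++ vac k.+2)) -!nseqD; congr nseq; lia.
have turnE f' r : turn_left Q T u f' (false :: r) = (Q ^+ 2 * u ^+ 2 - 1) * f' (false :: r)
     + Q * (T - u) * f' (true :: r).
  by rewrite /turn_left /op /op0 /= drop0.
rewrite [triangle _ _ _ _ (u :: vs)]/= turnE line_cat -/k /= add0n -/H -/G.
rewrite line_true_vac line_vac; last by move=> p; apply: G0.
rewrite G0 ?size_nseq // !mulr0 addr0.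
have -> : G (vac (size vs) ++ [:: false, false & vac k.+1]) = (Q ^+ 2 - 1) * cup k H (vac k.*2.+1).
  have -> : vac k.*2.+1 = vac k ++ vac k.+1 by rewrite -nseqD; congr nseq; lia.
  rewrite /G /vertex /cup -[X in op X](addn0 k) -[X in op (X + _)](size_nseq k false) !op_cat.
  rewrite /op /= /op0 /= mulfV //; ring.
rewrite /H push_right // move_left_vac ?size_rev -/k; last lia.
rewrite triangle_linear triangle_zero mulr0 add0r big_bool /= big_rev /is_one /=; ring.
Qed.

(** At the centre the weight of a zero entry between equal bits vanishes. As the column bit is
    false, the row leaves the centre with true, is frozen from there on, and leaves its negated bit
    in the central column, so that [push_left] applies. *)
Lemma triangle_freeze_left u w us : Q ^+ 2 * (u * w) = 1 -> all (predC1 0) us -> T != 0 ->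
  triangle Q T w is_one (u :: us ++ [:: T]) (vac (size us).+2.*2.+1)
  = (Q ^+ 2 - 1) * (1 - u ^+ 2)
    * (\prod_(y <- us ++ [:: T]) (Q * (1 - u * y)) * \prod_(y <- us ++ [:: T]) (Q * (1 - y * w)))
    * (Q * (u * (Q ^+ 2 * (T * u) - 1)))
    * triangle Q T u is_one (us ++ [:: T]) (vac (size us).+1.*2.+1).
Proof.
move=> uw us0 T0; pose vs := us ++ [:: T]; rewrite -/vs.
have vs0 : all (predC1 0) vs by rewrite all_cat us0 /= T0.
pose k := size vs; have kE : k = (size us).+1 by rewrite /k size_cat addn1.
rewrite -kE.
pose tri := triangle Q T w is_one vs.
pose H := line Q u (rev vs) k.+1 (turn_right Q T u k.*2.+1 tri).
pose G := vertex Q (u * w) k H.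
pose C := (Q ^+ 2 - 1) * (1 - u ^+ 2) * \prod_(y <- vs) (Q * (1 - u * y)).
have HE p : size p = k.+1 -> H (p ++ true :: vac k.+1)
    = (\prod_(y <- vs) (Q * (1 - u * y))) * (Q * (1 - u ^+ 2)) * tri (p ++ vac k).
  have kr : k = size (rev vs) by rewrite size_rev.
  rewrite kr => sp; rewrite /H kr -[X in line _ _ _ X]addn0 -sp line_pass.
  have -> : true :: vac (size p) = true :: vac (size (rev vs)) ++ [:: false].
    by rewrite -[[:: false]]/(vac 1) -nseqD addn1 sp.
  rewrite line_true_vac big_rev /= -mulrA; congr (_ * _).
  rewrite catA /turn_right.
  have -> : (size (rev vs)).*2.+1 = (size (p ++ vac (size (rev vs))) + 0)%N.
    by rewrite size_cat size_nseq sp; lia.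
  by rewrite op_cat /op /op0 /= cats0.
(* The two weights that remain at the centre, [Q ^+ 2 - 1] and [Q * (1 - u * w)], have ratio [Q], as
   those of [flip]. *)
have GE p b : size p = k -> G (p ++ b :: false :: vac k.+1) = C * flip Q k tri (p ++ b :: vac k).
  move=> sp; rewrite /G /flip /vertex -[k in op k]addn0 -[X in op (X + _)]sp !op_cat.
  have HE' a : H (p ++ [:: a, true, false & vac k])
      = \prod_(y <- vs) (Q * (1 - u * y)) * (Q * (1 - u ^+ 2)) * tri (p ++ a :: vac k).
    by have := HE (rcons p a); rewrite size_rcons sp => /(_ erefl); rewrite !cat_rcons.
  by rewrite /op /op0 /= !drop0 /C; case: b => /=; rewrite !HE'; ring: uw.
have -> : vac k.+1.*2.+1 = false :: vac k ++ false :: vac k.+1.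
  by rewrite -[RHS]/(vac 1 ++ (vac k ++ vac k.+2)) -!nseqD; congr nseq; lia.
have lineE b : line Q u (vs ++ w :: rev vs) 0 (turn_right Q T u k.*2.+1 tri)
      (b :: vac k ++ false :: vac k.+1)
    = C * line Q u vs 0 (flip Q k tri) (b :: vac k ++ vac k).
  rewrite line_cat add0n -/k /= -/H -/G.
  rewrite (@line_ext _ Q u vs G (scale C (flip Q k tri)) b (vac k) _ (vac k)) ?size_nseq //.
    by rewrite -scale_line scaleE.
  by move=> p h sp; rewrite GE // scaleE.
have -> : vac k.*2.+1 = false :: vac k ++ vac k.
  by rewrite -[RHS]/(vac 1 ++ (vac k ++ vac k)) -!nseqD; congr nseq; lia.
transitivity (C * turn_left Q T u (line Q u vs 0 (flip Q k tri)) (false :: vac k ++ vac k)).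
  rewrite /= /turn_left /op /op0 /= !drop0 !lineE; ring.
rewrite push_left // scaleE -[false :: _]/(vac 1 ++ (vac k ++ vac k)) -!nseqD.
rewrite move_right_vac -/k; last lia.
rewrite triangle_linear triangle_zero mulr0 add0r big_bool /C /is_one /=.
(* The scalars of [push_left] and the crossing factors of [move_right] combine to vertex weights of
   the square. *)
have -> : \prod_(y <- vs) (Q * (1 - y * w))
    = \prod_(y <- vs) (Q * (y * w)) * \prod_(y <- vs) (Q ^+ 2 * (u / y) - 1).
  rewrite -big_split /=; apply: eq_big_seq => y yvs.
  by have y0 : y != 0 := allP vs0 y yvs; field: uw.
ring.
Qed.

End Freezing.

Section Square.

Local Open Scope ring_scope.
Variables (R : comNzRingType) (Q : R).
Implicit Types (f g : seq bool -> R) (s t p r : seq bool).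
Implicit Types (c w x y z u : R) (ys zs us : seq R) (k l n : nat).

Notation vac n := (nseq n false).

Definition enter f := op 0 0 1 (fun _ t => (~~ nth false t 0)%:R) f.
Definition leave k f := op k 1 0 (fun p _ => (nth false p 0)%:R) f.

(** The six-vertex partition function with domain wall boundary, when evaluated at the all-false
    state. *)
Fixpoint square us ys : seq bool -> R :=
  if us is u :: us' then enter (line Q u ys 0 (leave (size ys) (square us' ys)))
  else fun s => (s == nseq (size ys) true)%:R.

Lemma enterE f s : enter f s = f (false :: s).
Proof. by rewrite /enter /op /op0 /= drop0 mul1r mul0r addr0. Qed.

Lemma enter_op l i j M f : enter (op l.+1 i j M f) = op l i j M (enter f).
Proof. by rewrite /enter op_comm_le // addn0 subn1. Qed.

Lemma leave_op k l M f : (l + 2 <= k)%N -> leave k (op l 2 2 M f) = op l 2 2 M (leave k f).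
Proof. by move=> le_lk; rewrite /leave [RHS]op_comm_le // addnK. Qed.

Lemma enter_line x ys k f : enter (line Q x ys k.+1 f) = line Q x ys k (enter f).
Proof. by rewrite /enter op_line // addn0 subn1. Qed.

Lemma leave_line x ys k l f : (k + size ys < l)%N ->
  leave l (line Q x ys k f) = line Q x ys k (leave l f).
Proof. by move=> lt_l; rewrite /leave line_op. Qed.

(** The row crossing acts by the same scalar on the two false bits entering the rows and on the two
    true bits leaving them. *)
Lemma square_swap_head z y us ys s :
  (Q ^+ 2 * z - 1) * square (y :: z * y :: us) ys s
  = (Q ^+ 2 * z - 1) * square (z * y :: y :: us) ys s.
Proof.
pose n := size ys; pose f := square us ys.
have expand a b : square [:: a, b & us] ys
    = enter (enter (line Q a ys 1 (line Q b ys 0 (leave n.+1 (leave n f))))).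
  rewrite /= -/n -/f {1}/leave -enter_op -/(leave _ _) -enter_line leave_line //.
have top g s' : enter (enter (row_cross Q z 0 g)) s' = (Q ^+ 2 * z - 1) * enter (enter g) s'.
  by rewrite !enterE /row_cross /op /op0 /= drop0; ring.
have bottom k h : row_cross Q z k (leave k.+1 (leave k h))
    = scale (Q ^+ 2 * z - 1) (leave k.+1 (leave k h)).
  elim: k h => [|k IHk] h; apply: functional_extensionality => s'; last first.
    rewrite scaleE; case: s' => [|b s']; first by rewrite mulr0.
    by have := equal_f (IHk (fun t => h (b :: t))) s'; rewrite scaleE.
  case: s' => [|a [|b s']]; rewrite scaleE /row_cross /leave /op /= /op0 /= ?(mulr0, addr0) //.
  by case: a b => [] []; rewrite /= ?drop0; ring.
transitivity (enter (enter (row_cross Q z 0 (line Q y ys 1 (line Q (z * y) ys 0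
    (leave n.+1 (leave n f)))))) s); first by rewrite top expand.
by rewrite line_row_cross add0n bottom -!scale_line expand !enterE scaleE.
Qed.

Lemma col_cross_enter z k f : col_cross Q z k (enter f) = enter (col_cross Q z k.+1 f).
Proof. by rewrite /col_cross enter_op. Qed.

(** The crossing travels down to the bottom, where all columns are true and it acts by a scalar. *)
Lemma square_col_cross z y us ps qs :
  col_cross Q z (size ps) (square us (ps ++ [:: y, z * y & qs]))
  = scale (Q ^+ 2 * z - 1) (square us (ps ++ [:: z * y, y & qs])).
Proof.
elim: us => [|u us IHus] /=.
  apply: functional_extensionality => s; rewrite scaleE !size_cat /=.
  elim: ps s => [|p ps IHps] s /=.
    case: s => [|a [|b s]]; rewrite /col_cross /op /= /op0 /= ?eqseq_cons ?andbF ?(mulr0, addr0) //.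
    by case: a b => [] []; rewrite /= ?drop0 ?eqseq_cons /=; ring.
  case: s => [|[] s]; first by rewrite mulr0.
    exact: IHps.
  rewrite -[LHS]/(col_cross Q z (size ps) (fun=> 0) s) mulr0.
  have -> : (fun _ : seq bool => 0) = scale 0 (fun _ => 0 : R).
    by apply: functional_extensionality => t; rewrite scaleE mul0r.
  by rewrite /col_cross -scale_op scaleE mul0r.
rewrite col_cross_enter !size_cat /=.
rewrite -[size ps]add0n line_col_cross add0n /col_cross -leave_op; last by lia.
rewrite -/(col_cross _ _ _ _) IHus.
by rewrite /enter /leave -scale_op -scale_line -scale_op.
Qed.

Lemma leaveE k f p b : size p = k -> leave k f (p ++ [:: b]) = b%:R * f p.
Proof.
by move=> <-; rewrite /leave -[size p]addn0 op_cat /op /op0 /= cats0.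
Qed.

Lemma vertex_catE z f p h v r :
  vertex Q z (size p) f (p ++ [:: h, v & r])
  = sum_bits 2 (fun t => weight Q z h v (nth false t 0) (nth false t 1) * f (p ++ t ++ r)).
Proof. by rewrite /vertex -[size p]addn0 op_cat /op /op0 /= drop0. Qed.

(** Each row must leave with true, which against a true column only a zero entry between true bits
    allows; so the column is frozen. *)
Lemma square_col_last w us ys s : size s = size ys ->
  square us (rcons ys w) (rcons s true) = (\prod_(r <- us) (Q ^+ 2 * (r * w) - 1)) * square us ys s.
Proof.
elim: us s => [|u us IHus] s ss /=.
  by rewrite big_nil mul1r size_rcons -[(size ys).+1]addn1 nseqD cats1 eqseq_rcons andbT.
rewrite big_cons !enterE size_rcons -!cats1 line_cat add0n /=.
set c := \prod_(r <- us) _; pose g := scale ((Q ^+ 2 * (u * w) - 1) * c)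
  (leave (size ys) (square us ys)).
rewrite (@line_ext _ Q u ys _ g false s _ [::]) //; last first.
  move=> p b sp; rewrite /g scaleE leaveE // -sp vertex_catE /= sp.
  rewrite -!(cat_rcons _ p) !leaveE ?size_rcons ?sp //.
  by rewrite !cats1 IHus // /c; case: b => /=; ring.
by rewrite cats0 /g -scale_line scaleE.
Qed.

Lemma square_col_first w us ys s :
  square us (w :: ys) (true :: s) = (\prod_(r <- us) (Q * (1 - r * w))) * square us ys s.
Proof.
elim: us s => [|u us IHus] s /=; first by rewrite big_nil mul1r eqseq_cons.
rewrite big_cons !enterE vertexE /= !mul0r ?addr0 ?add0r line_cons -[in RHS]mulrA; congr (_ * _).
set c := \prod_(r <- us) _.
rewrite -[RHS]scaleE scale_line; congr (line _ _ _ _ _ _).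
apply: functional_extensionality => t.
rewrite -[LHS]/(leave (size ys) (fun r => square us (w :: ys) (true :: r)) t).
rewrite /leave scale_op; congr op; apply: functional_extensionality => r.
by rewrite scaleE IHus.
Qed.

(** The corner vertex has parameter 1 and forces equal incoming bits, so the 1 of the top row lies
    in the last column. *)
Lemma square_freeze_right u w us ys : u * w = 1 ->
  square (u :: us) (rcons ys w) (vac (size ys).+1)
  = (\prod_(y <- ys) (Q ^+ 2 * (u * y) - 1)) * (Q ^+ 2 - 1)
    * (\prod_(r <- us) (Q ^+ 2 * (r * w) - 1)) * square us ys (vac (size ys)).
Proof.
move=> uw; rewrite /= enterE size_rcons -{1}cats1 line_cat add0n /= uw.
have -> : [:: false, false & vac (size ys)] = false :: vac (size ys) ++ [:: false].
  by rewrite -[[:: false] in RHS]/(vac 1) -nseqD addn1.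
have leave_col b : leave (size ys).+1 (square us (rcons ys w)) (vac (size ys) ++ [:: b; true])
    = square us (rcons ys w) (rcons (vac (size ys)) b).
  by rewrite -cat_rcons leaveE ?size_rcons ?size_nseq // mul1r.
have leave_col0 b : leave (size ys).+1 (square us (rcons ys w)) (vac (size ys) ++ [:: b; false]) = 0.
  by rewrite -cat_rcons leaveE ?size_rcons ?size_nseq // mul0r.
rewrite line_vac => [|p sp]; last first.
  by rewrite -sp vertex_catE /= subrr; ring.
have := vertex_catE 1 (leave (size ys).+1 (square us (rcons ys w))) (vac (size ys)) false false [::].
rewrite size_nseq => -> /=; rewrite !leave_col !leave_col0 square_col_last ?size_nseq //; ring.
Qed.

(** The zero entry has weight 0 at the corner, so the 1 of the top row lies in the first column. *)
Lemma square_freeze_left u w us ys : Q ^+ 2 * (u * w) = 1 ->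
  square (u :: us) (w :: ys) (vac (size ys).+1)
  = (Q ^+ 2 - 1) * (\prod_(y <- ys) (Q * (1 - u * y)))
    * (\prod_(r <- us) (Q * (1 - r * w))) * square us ys (vac (size ys)).
Proof.
move=> uw; rewrite /= enterE vertexE /= uw subrr !mul0r ?add0r ?addr0 line_cons.
have -> : true :: vac (size ys) = true :: vac (size ys) ++ [::] by rewrite cats0.
rewrite line_true_vac -[X in X ++ [:: true]]/(vac (size ys)).
have -> : leave (size ys).+1 (square us (w :: ys)) (true :: vac (size ys) ++ [:: true])
    = square us (w :: ys) (true :: vac (size ys)).
  by rewrite -cat_cons leaveE /= ?size_nseq // mul1r.
rewrite square_col_first; ring.
Qed.

End Square.

(** * Ring morphisms and degree bounds *)

Section Extensionality.

Local Open Scope ring_scope.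

Lemma eq_op (A : comNzRingType) k i j (M M' : seq bool -> seq bool -> A) (f f' : seq bool -> A) s :
  (forall p t, M p t = M' p t) -> f =1 f' -> op k i j M f s = op k i j M' f' s.
Proof.
move=> eqM /functional_extensionality ->; congr (op _ _ _ _ _ _).
by apply: functional_extensionality => p; apply: functional_extensionality => t.
Qed.

Lemma eq_line (A : comNzRingType) (Q x : A) ys k (f f' : seq bool -> A) s :
  f =1 f' -> line Q x ys k f s = line Q x ys k f' s.
Proof. by move=> /functional_extensionality ->. Qed.

End Extensionality.

Section Morphism.

Local Open Scope ring_scope.
Variables (R S : comNzRingType) (phi : {rmorphism R -> S}).
Implicit Types (f g : seq bool -> R) (s t p r : seq bool).
Implicit Types (w x y z u Q T : R) (ys zs us : seq R) (k l n : nat).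

Lemma map_sum_bits j (F : seq bool -> R) : phi (sum_bits j F) = sum_bits j (fun t => phi (F t)).
Proof. by elim: j F => //= j IHj F; rewrite rmorphD !IHj. Qed.

Lemma map_op k i j M f s :
  phi (op k i j M f s) = op k i j (fun p t => phi (M p t)) (fun r => phi (f r)) s.
Proof.
elim: k f s => [|k IHk] f s; last by case: s => [|b s]; rewrite ?rmorph0 //; apply: IHk.
rewrite /op /op0; case: ifP => _; first exact: rmorph0.
by rewrite map_sum_bits; apply: eq_sum_bits => t _; rewrite rmorphM.
Qed.

Lemma map_weight Q z h v v' h' : phi (weight Q z h v v' h') = weight (phi Q) (phi z) h v v' h'.
Proof.
by case: h v v' h' => [] [] [] []; rewrite /= ?(rmorph0, rmorph1, rmorphM, rmorphB, rmorphXn).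
Qed.

Lemma map_line Q x ys k f s :
  phi (line Q x ys k f s) = line (phi Q) (phi x) (map phi ys) k (fun r => phi (f r)) s.
Proof.
elim: ys k s => //= y ys IHys k s; rewrite map_op /vertex; apply: eq_op => // p t.
by rewrite map_weight rmorphM.
Qed.

Lemma map_triangle Q T w (g : bool -> R) us s :
  phi (triangle Q T w g us s)
  = triangle (phi Q) (phi T) (phi w) (fun m => phi (g m)) (map phi us) s.
Proof.
elim: us s => [|u us IHus] s /=.
  by case: s => [|m [|b s]]; rewrite ?rmorph0.
rewrite /turn_left map_op; apply: eq_op => [p t|r].
  case: (nth _ p 0) (nth _ t 0) => [] [];
  by rewrite /= ?(rmorph0, rmorph1, rmorphM, rmorphB, rmorphXn).
rewrite map_line map_cat /= map_rev size_map; apply: eq_line => r'.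
rewrite /turn_right map_op; apply: eq_op => // p t.
by case: (nth _ p 0) (nth _ p 1) => [] [];
  rewrite /= ?(rmorph0, rmorph1, rmorphM, rmorphB, rmorphXn).
Qed.

Lemma map_square Q us ys s :
  phi (square Q us ys s) = square (phi Q) (map phi us) (map phi ys) s.
Proof.
elim: us s => [|u us IHus] s /=; first by rewrite rmorph_nat size_map.
rewrite !enterE map_line size_map; apply: eq_line => r.
by rewrite /leave map_op; apply: eq_op => // p t; rewrite rmorph_nat.
Qed.

End Morphism.

Section Degree.

Local Open Scope ring_scope.
Variable F : fieldType.
Implicit Types (f g : seq bool -> {poly F}) (s t p r : seq bool) (d k l : nat).
Implicit Types (Q T x : F) (ys us : seq F).

(** Degree bound in the parameter of column [k]. While its bit is false the column still has to
    receive an entry 1, whose weight is constant; this lowers the bound by one. *)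
Definition size_le f d k := forall s, (size (f s) <= d + nth false s k)%N.

Lemma size_sum_bits j (G : seq bool -> {poly F}) n :
  (forall t, size t = j -> (size (G t) <= n)%N) -> (size (sum_bits j G) <= n)%N.
Proof.
elim: j G => [|j IHj] G leG /=; first exact: leG.
apply: leq_trans (size_polyD _ _) _.
by rewrite geq_max !IHj // => t st; apply: leG; rewrite /= st.
Qed.

Lemma size_op l i j (M : seq bool -> seq bool -> {poly F}) f n s :
  (forall p q r t, s = p ++ q ++ r -> size p = l -> size q = i -> size t = j ->
     (size (M q t * f (p ++ t ++ r))%R <= n)%N) ->
  (size (op l i j M f s) <= n)%N.
Proof.
move=> len; case: (ltnP (size s) (l + i)) => [lts|les].
  by rewrite op_short // size_poly0.
have sp : size (take l s) = l by rewrite size_takel //; lia.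
have sq : size (take i (drop l s)) = i by rewrite size_takel // size_drop; lia.
have sE : s = take l s ++ take i (drop l s) ++ drop i (drop l s) by rewrite !cat_take_drop.
rewrite {1}sE -[X in op X]addn0 -{1}sp op_cat /op /op0 size_cat sq ltnNge leq_addr /=.
apply: size_sum_bits => t st; rewrite take_size_cat // drop_size_cat //.
exact: len.
Qed.

Lemma size_mul_const (a b : {poly F}) n :
  (size a <= 1)%N -> (size b <= n)%N -> (size (a * b)%R <= n)%N.
Proof. by move=> /size1_polyC -> ?; rewrite mul_polyC (leq_trans (size_scale_leq _ _)). Qed.

Lemma size_le_op_left l i j (M : seq bool -> seq bool -> {poly F}) f d k :
  (l + j <= k)%N -> (forall p t, (size (M p t) <= 1)%N) ->
  size_le f d k -> size_le (op l i j M f) d (k + i - j).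
Proof.
move=> le_k M1 lef s; apply: size_op => p q r t sE sp sq st.
apply: size_mul_const => //; apply: leq_trans (lef _) _.
rewrite sE !nth_cat sp sq st leq_add2l.
have -> : (k < l)%N = false by lia.
have -> : (k - l < j)%N = false by lia.
have -> : (k + i - j < l)%N = false by lia.
have -> : (k + i - j - l < i)%N = false by lia.
by have -> : (k + i - j - l - i = k - l - j)%N by lia.
Qed.

Lemma size_le_op_right l i j (M : seq bool -> seq bool -> {poly F}) f d k :
  (k < l)%N -> (forall p t, (size (M p t) <= 1)%N) ->
  size_le f d k -> size_le (op l i j M f) d k.
Proof.
move=> lt_k M1 lef s; apply: size_op => p q r t sE sp sq st.
apply: size_mul_const => //; apply: leq_trans (lef _) _.
by rewrite sE !nth_cat sp lt_k.
Qed.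

Lemma size_weight_const Q x h v v' h' : (size (weight Q%:P x%:P h v v' h') <= 1)%N.
Proof.
have := map_weight (polyC : {rmorphism F -> {poly F}}) Q x h v v' h'.
by move=> <-; apply: size_polyC_leq1.
Qed.

Lemma size_le_line_left Q x ys k0 f d k : (k0 + size ys < k)%N ->
  size_le f d k -> size_le (line Q%:P x%:P (map polyC ys) k0 f) d k.
Proof.
elim: ys k0 => [|y ys IHys] k0 //= lt_k lef.
rewrite -[k](addnK 2); apply: size_le_op_left; first by lia.
  by move=> p t; rewrite -polyCM; apply: size_weight_const.
by apply: IHys => //; lia.
Qed.

Lemma size_le_line_right Q x ys k0 f d k : (k < k0)%N ->
  size_le f d k -> size_le (line Q%:P x%:P (map polyC ys) k0 f) d k.
Proof.
elim: ys k0 => [|y ys IHys] k0 //= lt_k lef; apply: size_le_op_right => //.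
  by move=> p t; rewrite -polyCM; apply: size_weight_const.
by apply: IHys => //; lia.
Qed.

Lemma size_affine (c e : F) : (size (c%:P * 'X + e%:P)%R <= 2)%N.
Proof. by rewrite size_MXaddC; case: ifP => // _; rewrite ltnS size_polyC_leq1. Qed.

Lemma size_weightX Q x h v v' h' :
  (size (weight Q%:P (x%:P * 'X) h v v' h') <= 1 + ~~ (~~ v && v'))%N.
Proof.
have a2 : (size (Q%:P ^+ 2 * (x%:P * 'X) - 1)%R <= 2)%N.
  by rewrite (_ : _ - 1 = (Q ^+ 2 * x)%:P * 'X + (- 1)%:P) ?size_affine //; ring.
have b2 : (size (Q%:P * (1 - x%:P * 'X))%R <= 2)%N.
  by rewrite (_ : _ * _ = (- (Q * x))%:P * 'X + Q%:P) ?size_affine //; ring.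
have c2 : (size ((Q%:P ^+ 2 - 1) * (x%:P * 'X))%R <= 2)%N.
  by rewrite (_ : _ * _ = ((Q ^+ 2 - 1) * x)%:P * 'X + 0%:P) ?size_affine //; ring.
have c1 : (size (Q%:P ^+ 2 - 1)%R <= 1)%N.
  by rewrite (_ : _ - 1 = (Q ^+ 2 - 1)%:P) ?size_polyC_leq1 //; ring.
by case: h v v' h' => [] [] [] [] /=; rewrite ?size_poly0 // ?(a2, b2, c2, c1).
Qed.

(** The tracked column stands at [k.+1] before the vertex and at [k] after it. A vertex adds one
    degree unless it changes the bit from false to true. *)
Lemma size_le_vertex Q x k f d :
  size_le f d k -> size_le (vertex Q%:P (x%:P * 'X) k f) d.+1 k.+1.
Proof.
move=> lef s; apply: size_op => p q r t sE sp sq st.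
have := lef (p ++ t ++ r).
rewrite sE !nth_cat sp sq ltnn subnn st /=.
have -> : (k.+1 < k)%N = false by lia.
have -> /= : (k.+1 - k)%N = 1%N by lia.
move=> fle; have wle := size_weightX Q x (nth false q 0) (nth false q 1) (nth false t 0) (nth false t 1).
apply: leq_trans (size_polyMleq _ _) _.
move: wle fle; set a := size (polyseq _); set b := size (polyseq (f _)); move: a b => a b.
by case: (nth false q 1) (nth false t 0) => [] [] /=; lia.
Qed.

Lemma size_triangle Q T us :
  size_le (triangle Q%:P T%:P 'X (fun m => m%:R) (map polyC us)) (size us) (size us).
Proof.
elim: us => [|u us IHus].
  by case=> [|[] [|b s]]; rewrite /= ?size_poly0 ?size_poly1.
rewrite /= size_map -[X in size_le _ _ X](addnK 1).
apply: (@size_le_op_left 0 1 1 _ _ _ (size us).+1) => //.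
  move=> p t; rewrite (_ : left_weight _ _ _ _ _ = (left_weight Q T u (nth false p 0) (nth false t 0))%:P)
    ?size_polyC_leq1 //.
  by case: (nth _ p 0) (nth _ t 0) => [] [];
    rewrite /= ?(polyCM, polyCB, polyC_exp, polyC1, polyC0).
rewrite line_cat size_map add0n; apply: size_le_line_left; first by lia.
apply: size_le_vertex; rewrite -map_rev; apply: size_le_line_right => //.
apply: size_le_op_right => //; first by lia.
move=> p t; rewrite (_ : right_weight _ _ _ _ _ = (right_weight Q T u (nth false p 0) (nth false p 1))%:P)
  ?size_polyC_leq1 //.
by case: (nth _ p 0) (nth _ p 1) => [] [];
  rewrite /= ?(polyCM, polyCB, polyC_exp, polyC1, polyC0).
Qed.

Lemma size_square Q us ys :
  size_le (square Q%:P (map polyC us) (rcons (map polyC ys) 'X)) (size us) (size ys).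
Proof.
elim: us => [|u us IHus].
  move=> s /=; case: eqP => [-> | _]; last by rewrite size_poly0.
  by rewrite size_rcons size_map nth_nseq ltnSn size_poly1.
rewrite -[X in size_le _ _ X]addn0 -[X in size_le _ _ X](addnK 1) addn0 /=.
have -> : (size ys + 1 - 1 = (size ys).+1 + 0 - 1)%N by lia.
rewrite size_rcons size_map -cats1 line_cat size_map add0n.
have n1 (b : bool) : (size (b%:R : {poly F}) <= 1)%N by case: b; rewrite ?size_poly1 ?size_poly0.
apply: (@size_le_op_left 0 0 1 _ _ _ (size ys).+1) => //.
apply: size_le_line_left => //; apply: size_le_vertex.
by apply: size_le_op_right => //; rewrite cats1.
Qed.

End Degree.

(** * Proportionality of the two partition functions *)

Section Identity.

Local Open Scope ring_scope.
Variables (F : fieldType) (Q T : F).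
Hypotheses (Q0 : Q != 0) (Q4 : Q ^+ 4 != 1) (T0 : T != 0).
Implicit Types (w x y z u : F) (ps qs ys us : seq F) (n : nat).

Notation vac n := (nseq n false).

Lemma bring_front (A : Type) (Phi : seq F -> A) ps u qs :
    (forall ps' a b qs', a != 0 -> b != 0 ->
      Phi (ps' ++ [:: a, b & qs']) = Phi (ps' ++ [:: b, a & qs'])) ->
  all (predC1 0) (u :: ps) -> Phi (ps ++ u :: qs) = Phi (u :: ps ++ qs).
Proof.
move=> swap; elim/last_ind: ps qs => //= ps a IHps qs.
rewrite all_rcons => /and3P[u0 a0 ps0]; rewrite !cat_rcons swap // IHps //=.
by rewrite u0.
Qed.

(* The crossing factors of the ratios [b / a] and [a / b] do not both vanish. *)
Lemma swap_factor a b : a != 0 -> b != 0 ->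
  (Q ^+ 2 * (b / a) - 1 != 0) || (Q ^+ 2 * (a / b) - 1 != 0).
Proof.
move=> a0 b0; rewrite -negb_and; apply: contraNN Q4 => /andP[/eqP ab /eqP ba].
apply/eqP; transitivity ((Q ^+ 2 * (b / a)) * (Q ^+ 2 * (a / b))); first by field; rewrite a0 b0.
by move/eqP: ab; move/eqP: ba; rewrite !subr_eq0 => /eqP-> /eqP->; rewrite mulr1.
Qed.

(** All columns start with false, so both crossings in [triangle_swap] act by the same scalar. If it
    vanishes for one order of the two parameters, it does not for the other. *)
Lemma triangle_swap_vac w (g : bool -> F) ps a b qs : a != 0 -> b != 0 ->
  triangle Q T w g (ps ++ [:: a, b & qs]) (vac (size ps + size qs).+2.*2.+1)
  = triangle Q T w g (ps ++ [:: b, a & qs]) (vac (size ps + size qs).+2.*2.+1).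
Proof.
set N := _.+1; move=> a0 b0; wlog nz : a b a0 b0 / Q ^+ 2 * (b / a) - 1 != 0 => [thw|].
  by case/orP: (swap_factor a0 b0) => nz; [|symmetry]; apply: thw.
have := triangle_swap Q T w g (b / a) a ps qs; rewrite divfK // => /equal_f/(_ (vac N)).
have leN : (size ps + (size qs).*2.+3 + 2 <= N)%N by rewrite /N; lia.
rewrite !col_cross_vac //; first by move/(mulfI nz).
by apply: leq_trans leN; rewrite leq_add2r leq_addr.
Qed.

Lemma square_swap_rows ps a b qs ys s : a != 0 -> b != 0 ->
  square Q (ps ++ [:: a, b & qs]) ys s = square Q (ps ++ [:: b, a & qs]) ys s.
Proof.
move=> a0 b0; elim: ps s => [|p ps IHps] s; last first.
  by rewrite /= !enterE; apply: eq_line => r; rewrite /leave; apply: eq_op.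
rewrite /=.
wlog nz : a b a0 b0 / Q ^+ 2 * (b / a) - 1 != 0 => [thw|].
  by case/orP: (swap_factor a0 b0) => nz; [|symmetry]; apply: thw.
by have := square_swap_head Q (b / a) a qs ys s; rewrite divfK // => /(mulfI nz).
Qed.

Lemma square_swap_cols us ps a b qs : a != 0 -> b != 0 ->
  square Q us (ps ++ [:: a, b & qs]) (vac (size ps + size qs).+2)
  = square Q us (ps ++ [:: b, a & qs]) (vac (size ps + size qs).+2).
Proof.
set N := _.+2; move=> a0 b0.
wlog nz : a b a0 b0 / Q ^+ 2 * (b / a) - 1 != 0 => [thw|].
  by case/orP: (swap_factor a0 b0) => nz; [|symmetry]; apply: thw.
have := square_col_cross Q (b / a) a us ps qs; rewrite divfK // => /equal_f/(_ (vac N)).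
have leN : (size ps + 2 <= N)%N by rewrite /N; lia.
by rewrite scaleE col_cross_vac // => /(mulfI nz).
Qed.

Lemma triangle_front w (g : bool -> F) ps u qs : all (predC1 0) (u :: ps) ->
  triangle Q T w g (ps ++ u :: qs) (vac (size (ps ++ u :: qs)).*2.+1)
  = triangle Q T w g (u :: ps ++ qs) (vac (size (ps ++ u :: qs)).*2.+1).
Proof.
move=> nz; pose Phi us := triangle Q T w g us (vac (size us).*2.+1).
rewrite -/(Phi _) (@bring_front F Phi) // => [|ps' a b qs' a0 b0].
  by rewrite /Phi /= !size_cat /= addnS.
by rewrite /Phi !size_cat /= !addnS triangle_swap_vac.
Qed.

Lemma square_rows_front ps u qs ys s : all (predC1 0) (u :: ps) ->
  square Q (ps ++ u :: qs) ys s = square Q (u :: ps ++ qs) ys s.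
Proof.
move=> nz; apply: (@bring_front F (fun us => square Q us ys s)) => // ps' a b qs' a0 b0.
exact: square_swap_rows.
Qed.

Lemma square_cols_front us zs ps u qs : all (predC1 0) (u :: ps) ->
  square Q us (zs ++ ps ++ u :: qs) (vac (size (zs ++ ps ++ u :: qs)))
  = square Q us (zs ++ u :: ps ++ qs) (vac (size (zs ++ ps ++ u :: qs))).
Proof.
move=> nz; pose Phi ys := square Q us (zs ++ ys) (vac (size (zs ++ ys))).
rewrite -/(Phi _) (@bring_front F Phi) // => [|ps' a b qs' a0 b0].
  congr (square _ _ _ (nseq _ _)); by rewrite !size_cat /= !size_cat !addnS.
have szE c d : size ((zs ++ ps') ++ [:: c, d & qs']) = (size (zs ++ ps') + size qs').+2.
  by rewrite size_cat /= !addnS.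
by rewrite /Phi !catA !szE square_swap_cols.
Qed.

(** For a line [y] the freezing factors of triangle and square have the ratio [y] times the term
    given here, for left and right freezing alike. The term of [T] comes from the triangle with one
    line. *)
Definition vanishing_product us := \prod_(y <- us) ((Q ^+ 2 * (T * y) - 1) * (Q * (1 - T * y))).

Lemma triangle_square_root_right u us1 :
    u != 0 ->
    triangle Q T u (@is_one F) (us1 ++ [:: T]) (vac (size us1).+1.*2.+1)
      = (\prod_(y <- us1) y) * vanishing_product (us1 ++ [:: T])
        * square Q (us1 ++ [:: T]) (rcons us1 u) (vac (size us1).+1) ->
  triangle Q T u^-1 (@is_one F) (u :: us1 ++ [:: T]) (vac (size us1).+2.*2.+1)
  = (\prod_(y <- u :: us1) y) * vanishing_product (u :: us1 ++ [:: T])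
    * square Q (u :: us1 ++ [:: T]) (rcons (rcons us1 u) u^-1) (vac (size us1).+2).
Proof.
move=> u0 IH; rewrite triangle_freeze_right // IH.
have := @square_freeze_right F Q u u^-1 (us1 ++ [:: T]) (rcons us1 u).
rewrite size_rcons => -> //; last by rewrite mulfV.
rewrite /vanishing_product !big_cons -cats1 !big_cat /= !big_seq1; ring.
Qed.

Lemma triangle_square_root_left u w us1 :
    Q ^+ 2 * (u * w) = 1 -> all (predC1 0) us1 ->
    triangle Q T u (@is_one F) (us1 ++ [:: T]) (vac (size us1).+1.*2.+1)
      = (\prod_(y <- us1) y) * vanishing_product (us1 ++ [:: T])
        * square Q (us1 ++ [:: T]) (rcons us1 u) (vac (size us1).+1) ->
  triangle Q T w (@is_one F) (u :: us1 ++ [:: T]) (vac (size us1).+2.*2.+1)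
  = (\prod_(y <- u :: us1) y) * vanishing_product (u :: us1 ++ [:: T])
    * square Q (u :: us1 ++ [:: T]) (w :: rcons us1 u) (vac (size us1).+2).
Proof.
move=> uw us0 IH; rewrite (triangle_freeze_left (w := w)) // IH.
have := @square_freeze_left F Q u w (us1 ++ [:: T]) (rcons us1 u) uw.
rewrite size_rcons => ->.
rewrite /vanishing_product !big_cons -cats1 !big_cat /= !big_seq1; ring.
Qed.

Lemma horner_map_polyC w ys : map (horner_eval w) (map polyC ys) = ys.
Proof. by rewrite -map_comp map_id_in // => y _; rewrite /= /horner_eval hornerC. Qed.

Lemma horner_triangle us w n :
  (triangle Q%:P T%:P 'X (fun m => m%:R) (map polyC us) (vac n)).[w]
  = triangle Q T w (@is_one F) us (vac n).
Proof.
have := map_triangle (horner_eval w : {rmorphism {poly F} -> F}) Q%:P T%:P 'X (fun m => m%:R)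
  (map polyC us) (vac n).
rewrite /= horner_map_polyC /horner_eval !hornerC hornerX => ->.
by congr triangle; apply: functional_extensionality => m; case: m; rewrite /= ?hornerC ?horner0.
Qed.

Lemma horner_square us ys w n :
  (square Q%:P (map polyC us) (rcons (map polyC ys) 'X) (vac n)).[w]
  = square Q us (rcons ys w) (vac n).
Proof.
have := map_square (horner_eval w : {rmorphism {poly F} -> F}) Q%:P (map polyC us)
  (rcons (map polyC ys) 'X) (vac n).
by rewrite map_rcons /= !horner_map_polyC /horner_eval hornerC hornerX.
Qed.

(** Ensures that the interpolation points [u^-1] and one [(Q ^+ 2 * u0)^-1] exist and are
    distinct. *)
Definition generic us :=
  [&& all (predC1 0) us, uniq us & all (fun x => all (fun y => Q ^+ 2 * x != y) us) us].

Lemma generic_rem u ps qs : generic (ps ++ u :: qs) -> generic (ps ++ qs).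
Proof.
have sub x : x \in ps ++ qs -> x \in ps ++ u :: qs.
  by rewrite !mem_cat inE => /orP[]->; rewrite ?orbT.
case/and3P=> nz un ne; apply/and3P; split.
- by apply/allP => x /sub/(allP nz).
- by move: un; rewrite uniq_catC /= => /andP[_]; rewrite uniq_catC.
- by apply/allP => x /sub xin; apply/allP => y /sub; apply: (allP (allP ne x xin)).
Qed.

(** As polynomials in [w] both sides have size at most [(size us).+1]. By induction they agree at
    [u^-1] for all [u] in [us], by right freezing, and at one further point, by left freezing of a
    single [u0]. *)
Lemma triangle_square us w : generic us ->
  triangle Q T w (@is_one F) (us ++ [:: T]) (vac (size us).+1.*2.+1)
  = (\prod_(y <- us) y) * vanishing_product (us ++ [:: T])
    * square Q (us ++ [:: T]) (rcons us w) (vac (size us).+1).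
Proof.
move: {2}(size us) (erefl (size us)) => n; elim: n us w => [|n IHn] us w szn gus.
  rewrite (size0nil szn) /vanishing_product big_nil big_seq1 /=.
  rewrite /turn_left /vertex /turn_right /enter /leave /op /= /op0 /= /is_one /=; ring.
pose c := (\prod_(y <- us) y) * vanishing_product (us ++ [:: T]).
pose pT := triangle Q%:P T%:P 'X (fun m => m%:R) (map polyC (us ++ [:: T])) (vac (size us).+1.*2.+1).
pose pS := square Q%:P (map polyC (us ++ [:: T])) (rcons (map polyC us) 'X) (vac (size us).+1).
have [nz un ne] := and3P gus.
suff p0 : pT - c%:P * pS = 0.
  have /eqP := congr1 (horner^~ w) p0.
  by rewrite hornerD hornerN hornerM hornerC horner0 horner_triangle horner_square subr_eq0 => /eqP.
have [u0 u0us] : exists u0, u0 \in us by case: (us) szn => // a s _; exists a; apply: mem_head.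
have u0nz : u0 != 0 by apply: (allP nz).
apply: (@roots_geq_poly_eq0 _ _ ((Q ^+ 2 * u0)^-1 :: map (@GRing.inv F) us)).
- have split_at u : u \in us -> exists ps qs,
      [/\ us = ps ++ u :: qs, generic (ps ++ qs), all (predC1 0) (u :: ps) & size (ps ++ qs) = n].
    move=> uus; case/splitPr: uus szn gus nz => ps qs szn gus nz.
    exists ps, qs; move: szn; rewrite !size_cat /= addnS => -[szn]; split=> //.
      exact: generic_rem gus.
    by move: nz; rewrite all_cat /= => /and3P[-> ->].
  (* By the symmetry in the lines, the chosen [u] may be taken as the outermost one. *)
  have main x ps u qs : us = ps ++ u :: qs -> all (predC1 0) (u :: ps) ->
      triangle Q T x (@is_one F) (u :: (ps ++ qs) ++ [:: T]) (vac n.+2.*2.+1)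
        = (\prod_(y <- u :: ps ++ qs) y) * vanishing_product (u :: (ps ++ qs) ++ [:: T])
          * square Q (u :: (ps ++ qs) ++ [:: T]) (rcons us x) (vac n.+2) ->
      root (pT - c%:P * pS) x.
    move=> usE nzp; rewrite /root hornerD hornerN hornerM hornerC horner_triangle horner_square.
    have prodE (h : F -> F) rs : \prod_(y <- (ps ++ u :: qs) ++ rs) h y
        = \prod_(y <- u :: (ps ++ qs) ++ rs) h y.
      by rewrite -!catA !cat_cons !(big_cat, big_cons) /= mulrCA.
    have sz : size (ps ++ u :: (qs ++ [:: T])) = n.+2.
      by rewrite -cat_cons catA -usE size_cat szn addn1.
    have := triangle_front x (@is_one F) (qs ++ [:: T]) nzp.
    rewrite sz /c /vanishing_product szn usE prodE -!catA cat_cons => ->.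
    have := prodE id [::]; rewrite !cats0 square_rows_front // => -> ->.
    by rewrite subrr.
  apply/allP => x; rewrite inE => /predU1P[->|/mapP[u uus ->]].
    have [ps [qs [usE gen nzp szpq]]] := split_at _ u0us.
    have wu : Q ^+ 2 * (u0 * (Q ^+ 2 * u0)^-1) = 1 by field; rewrite Q0 u0nz.
    have nzpq : all (predC1 0) (ps ++ qs) by case/and3P: gen.
    apply: (main _ _ _ _ usE nzp); move: (triangle_square_root_left wu nzpq (IHn _ _ szpq gen)).
    rewrite szpq => ->; congr (_ * _); set x0 := (_ * _)^-1.
    have x0nz : x0 != 0 by rewrite invr_neq0 // mulf_neq0 // expf_neq0.
    set rs := _ :: _ ++ [:: T].
    have nzx : all (predC1 0) (x0 :: us) by rewrite /= x0nz.
    have -> : square Q rs (rcons us x0) (vac n.+2) = square Q rs (x0 :: us) (vac n.+2).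
      by have := square_cols_front rs [::] [::] nzx; rewrite /= cats0 cats1 size_rcons szn.
    have u0ps : all (predC1 0) (u0 :: ps ++ qs) by rewrite /= u0nz.
    (* Left freezing lists the columns as [x0], [ps ++ qs], [u0]; column symmetry restores the order
       of [us]. *)
    transitivity (square Q rs [:: x0, u0 & ps ++ qs] (vac n.+2)).
      by have := square_cols_front rs [:: x0] [::] u0ps; rewrite /= cats0 cats1 size_rcons szpq.
    by have := square_cols_front rs [:: x0] qs nzp; rewrite /= -usE szn => ->.
  have [ps [qs [usE gen nzp szpq]]] := split_at _ uus.
  have u_nz : u != 0 by apply: (allP nz).
  have nzpq : all (predC1 0) (u :: ps ++ qs) by rewrite /= u_nz; case/and3P: gen.
  apply: (main _ _ _ _ usE nzp); move: (triangle_square_root_right u_nz (IHn _ _ szpq gen)).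
  rewrite szpq => ->; congr (_ * _); set x0 := u^-1; set rs := _ :: _ ++ [:: T].
  transitivity (square Q rs (rcons (u :: ps ++ qs) x0) (vac n.+2)).
    have := square_cols_front rs [::] [:: x0] nzpq.
    by rewrite -cat_rcons /= !cats1 !size_rcons szpq.
  have := square_cols_front rs [::] (rcons qs x0) nzp.
  have -> : ps ++ u :: rcons qs x0 = rcons us x0 by rewrite usE rcons_cat.
  by rewrite /= size_rcons szn -rcons_cat => ->.
- rewrite /= map_inj_uniq ?un ?andbT; last exact: invr_inj.
  apply/mapP => -[y yus /invr_inj u0y].
  by have := allP (allP ne u0 u0us) y yus; rewrite /= u0y eqxx.
- rewrite /= size_map; apply: leq_trans (size_polyD _ _) _.
  rewrite size_polyN geq_max; apply/andP; split.
    apply: leq_trans (size_triangle Q T _ _) _.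
    by rewrite nth_nseq if_same addn0 size_cat addn1.
  apply: size_mul_const; first exact: size_polyC_leq1.
  apply: leq_trans (size_square Q _ _ _) _.
  by rewrite nth_nseq if_same addn0 size_cat addn1.
Qed.

End Identity.

(** * Specialization to equal parameters *)

Section Homogeneous.

Local Open Scope ring_scope.
Variables (F : numFieldType) (Q t : F).
Hypotheses (Q0 : Q != 0) (Q4 : Q ^+ 4 != 1) (t0 : t != 0).

Notation vac n := (nseq n false).

(* The points [t + i X] are distinct over the rational functions in [X] and all specialize to
   [t] at [X = 0]. *)
Definition line_point (i : nat) : {poly F} := t%:P + i.+1%:R *: 'X.

Lemma line_point0 i : (line_point i).[0] = t.
Proof. by rewrite hornerD hornerC hornerZ hornerX mulr0 addr0. Qed.

Lemma line_point_inj : injective line_point.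
Proof.
move=> i j /(congr1 (fun p : {poly F} => p.[1])).
rewrite /line_point !hornerD !hornerZ !hornerX !hornerC !mulr1 => /addrI/eqP.
by rewrite eqr_nat eqSS => /eqP.
Qed.

(** [triangle_square] needs a field: it is applied in the fraction field and pulled back by
    injectivity. Evaluations at 0 and 1 show that the points are generic. *)
Lemma triangle_square_poly n (us := map line_point (iota 0 n)) (T := t%:P) :
  triangle Q%:P T T (fun m => m%:R) (us ++ [:: T]) (vac n.+1.*2.+1)
  = (\prod_(y <- us) y)
    * (\prod_(y <- us ++ [:: T]) ((Q%:P ^+ 2 * (T * y) - 1) * (Q%:P * (1 - T * y))))
    * square Q%:P (us ++ [:: T]) (rcons us T) (vac n.+1).
Proof.
pose phi : {rmorphism {poly F} -> {fraction {poly F}}} := @tofrac {poly F}.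
have phi_inj : injective phi by move=> x y /eqP; rewrite tofrac_eq => /eqP.
have phi0 x : (phi x == 0) = (x == 0) by rewrite -(rmorph0 phi) (inj_eq phi_inj).
have eval0 (p : {poly F}) : p.[0] != 0 -> p != 0 by apply: contraNneq => ->; rewrite horner0.
have szus : size (map phi us) = n by rewrite !size_map size_iota.
have gen : generic (phi Q%:P) (map phi us).
  apply/and3P; split.
  - apply/allP => x /mapP[y /mapP[i _ ->] ->] /=; rewrite phi0 eval0 // line_point0.
    exact: t0.
  - by rewrite !map_inj_uniq ?iota_uniq //; exact: line_point_inj.
  - apply/allP => x /mapP[y /mapP[i _ ->] ->] /=; apply/allP => z /mapP[y' /mapP[j _ ->] ->].
    rewrite -rmorphXn -rmorphM (inj_eq phi_inj) -subr_eq0 eval0 //.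
    rewrite hornerD hornerN hornerM horner_exp hornerC !line_point0 subr_eq0.
    rewrite -[X in _ != X]mul1r (inj_eq (mulIf t0)).
    by apply: contraNneq Q4; rewrite (exprM Q 2 2) => ->; rewrite expr1n.
apply: (phi_inj); rewrite map_triangle !rmorphM map_square map_cat map_rcons /=.
have Q0' : phi Q%:P != 0 by rewrite phi0 polyC_eq0.
have Q4' : phi Q%:P ^+ 4 != 1.
  by rewrite -rmorphXn -(rmorph1 phi) (inj_eq phi_inj) -polyC_exp -polyC1 (inj_eq (@polyC_inj _)).
have T0' : phi T != 0 by rewrite phi0 polyC_eq0.
have := triangle_square Q0' Q4' T0' (phi T) gen; rewrite szus.
move=> key; etransitivity; [etransitivity; [|exact: key]|].
  by congr triangle; apply: functional_extensionality => m; apply: (rmorph_nat phi).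
congr (_ * _ * _); first by rewrite big_map; symmetry; apply: (rmorph_prod phi).
rewrite /vanishing_product -[[:: phi T]]/(map phi [:: T]) -map_cat big_map.
symmetry; rewrite (rmorph_prod phi); apply: eq_bigr => y _.
by rewrite !(rmorphM, rmorphB, rmorphXn, rmorph1).
Qed.

Lemma triangle_square_homogeneous n :
  triangle Q t t (fun m => m%:R) (nseq n.+1 t) (vac n.+1.*2.+1)
  = t ^+ n * ((Q ^+ 2 * (t * t) - 1) * (Q * (1 - t * t))) ^+ n.+1
    * square Q (nseq n.+1 t) (nseq n.+1 t) (vac n.+1).
Proof.
pose phi : {rmorphism {poly F} -> F} := horner_eval 0.
have phiC c : phi c%:P = c by apply: hornerC.
have := congr1 phi (triangle_square_poly n).
have map_us : map phi (map line_point (iota 0 n)) = nseq n t.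
  rewrite -map_comp -[in RHS](size_iota 0 n); elim: (iota 0 n) => //= i s ->.
  by congr (_ :: _); apply: line_point0.
have nseqS : nseq n.+1 t = nseq n t ++ [:: t] by rewrite -[[:: t]]/(nseq 1 t) -nseqD addn1.
have nseqSr : nseq n.+1 t = rcons (nseq n t) t by rewrite nseqS cats1.
rewrite map_triangle !rmorphM map_square map_cat map_rcons map_us !phiC.
rewrite -[map phi [:: t%:P]]/[:: phi t%:P] phiC -nseqS -nseqSr.
have prod_const (c : F) : \prod_(i <- iota 0 n) c = c ^+ n.
  by rewrite big_const_seq count_predT size_iota iter_mulr_1.
have phi_point i : phi (line_point i) = t by apply: line_point0.
have prod1 : phi (\prod_(y <- map line_point (iota 0 n)) y) = t ^+ n.
  by rewrite rmorph_prod big_map -prod_const; apply: eq_bigr => i _.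
pose c := (Q ^+ 2 * (t * t) - 1) * (Q * (1 - t * t)).
have prod2 : phi (\prod_(y <- map line_point (iota 0 n) ++ [:: t%:P])
    ((Q%:P ^+ 2 * (t%:P * y) - 1) * (Q%:P * (1 - t%:P * y)))) = c ^+ n.+1.
  rewrite big_cat big_seq1 rmorphM rmorph_prod big_map [RHS]exprSr -[c ^+ n]prod_const; congr (_ * _).
    by apply: eq_bigr => i _; rewrite !(rmorphM, rmorphB, rmorphXn, rmorph1) phi_point !phiC.
  by rewrite !(rmorphM, rmorphB, rmorphXn, rmorph1) !phiC.
rewrite prod1 prod2 => key; etransitivity; last exact: key.
by congr triangle; apply: functional_extensionality => m; rewrite rmorph_nat.
Qed.

End Homogeneous.

(** * Expansion over arrays *)

Section RowLists.

Implicit Types (h v : bool) (vs s : seq bool) (r : seq int) (A : seq (seq int)).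

Definition minus_count r := count_mem (-1)%R r.

Definition step vs r := [seq p.1 (+) (p.2 != 0%R) | p <- zip vs r].

(* The rows of entries compatible with the partial column sums [vs] whose partial sums go from
   [h] to [1]. *)
Fixpoint rows h vs : seq (seq int) :=
  if vs is v :: vs' then
    [seq 0%R :: r | r <- rows h vs']
    ++ (if h == v then [seq ((-1) ^+ h)%R :: r | r <- rows (~~ h) vs'] else [::])
  else if h then [:: [::]] else [::].

Fixpoint square_arrays k s : seq (seq (seq int)) :=
  if k is k'.+1 then
    [seq r :: A | r <- rows false s, A <- square_arrays k' (step s r)]
  else if s == nseq (size s) true then [:: [::]] else [::].

Definition middle s := behead (rev (behead (rev s))).

Fixpoint triangle_arrays k s : seq (seq (seq int)) :=
  if k is k'.+1 then
    [seq r :: A | r <- rows false (middle s), A <- triangle_arrays k' (step (middle s) r)]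
  else if s == [:: true] then [:: [::]] else [::].

Definition array_minus_count A := sumn (map minus_count A).

Lemma size_rows h vs r : r \in rows h vs -> size r = size vs.
Proof.
elim: vs h r => [|v vs IHvs] h r /=; first by case: h; rewrite ?inE // => /eqP->.
rewrite mem_cat => /orP[/mapP[r' /IHvs szr ->]|]; first by rewrite /= szr.
by case: ifP => // _ /mapP[r' /IHvs szr ->]; rewrite /= szr.
Qed.

Section Weights.

Local Open Scope ring_scope.
Variables (F : fieldType) (q : F).
Hypotheses (q0 : q != 0) (q4 : q ^+ 4 != 1).

Notation vac n := (nseq n false).

Let Q := q ^+ 2.
Let t := q^-1.
Let a := Q - 1.
Let c := Q ^+ 2 - 1.
Let x := (q ^+ 2 + 1) ^+ 2 / q ^+ 2.

Lemma a_neq0 : a != 0.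
Proof.
rewrite subr_eq0; apply: contraNneq q4; rewrite -[4%N]/(2 * 2)%N exprM -/Q => ->.
by rewrite expr1n.
Qed.

(** Zero entries all get weight [a]. The weight of -1 is written so that, multiplied by the weight
    [c] of a 1 paired with it, it gives [x * a ^+ 2]. *)
Lemma weight_hom h v v' h' : weight Q (t * t) h v v' h' =
  match h, v, v', h' with
  | false, false, false, false | true, true, true, true => a
  | false, true, true, false | true, false, false, true => a
  | false, false, true, true => c
  | true, true, false, false => x * a ^+ 2 / c
  | _, _, _, _ => 0
  end.
Proof.
have c0 : q ^+ 2 ^+ 2 - 1 != 0 by rewrite subr_eq0 -exprM.
case: h v v' h' => [] [] [] []; rewrite /= /a /c /x /t /Q //; field; rewrite ?q0 ?c0 //.
Qed.

(** From [h = false] one entry 1 stays unpaired and takes the place of a factor [a]; the [a] on the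
    left avoids the exponent [size vs - 1]. *)
Lemma line_hom f h vs s : (forall p, size p = size vs -> f (p ++ false :: s) = 0) ->
  a * line Q t (nseq (size vs) t) 0 f (h :: vs ++ s)
  = a ^+ size vs * (if h then a else c)
    * \sum_(r <- rows h vs) x ^+ minus_count r * f (step vs r ++ true :: s).
Proof.
have c0 : c != 0 by rewrite subr_eq0 -exprM.
elim: vs f h => [|v vs IHvs] f h f0.
  rewrite /=; case: h; last by rewrite (f0 [::]) // big_nil !mulr0.
  by rewrite big_seq1 /minus_count /= mul1r; ring.
have IH b h' : a * line Q t (nseq (size vs) t) 1 f (b :: h' :: vs ++ s)
  = a ^+ size vs * (if h' then a else c)
    * \sum_(r <- rows h' vs) x ^+ minus_count r * f (b :: step vs r ++ true :: s).
  by rewrite line_cons IHvs // => p sp; apply: (f0 (b :: p)); rewrite /= sp.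
have zero_rows : \sum_(r <- [seq 0 :: r | r <- rows h vs])
      x ^+ minus_count r * f (step (v :: vs) r ++ true :: s)
    = \sum_(r <- rows h vs) x ^+ minus_count r * f (v :: step vs r ++ true :: s).
  by rewrite big_map; apply: eq_bigr => r _; rewrite /minus_count /= addbF.
have sign_rows : \sum_(r <- [seq (-1) ^+ h :: r | r <- rows (~~ h) vs])
      x ^+ minus_count r * f (step (v :: vs) r ++ true :: s)
    = x ^+ h * \sum_(r <- rows (~~ h) vs) x ^+ minus_count r * f (~~ v :: step vs r ++ true :: s).
  rewrite big_map big_distrr; apply: eq_bigr => r _.
  by rewrite /= mulrA -exprD /minus_count /=; case: (h); rewrite ?expr1 ?expr0 /= ?addbT.
rewrite [line _ _ _ _ _]/= vertexE [in LHS]/sum_bits [nth _ _ _]/= [nth _ _ _]/= !weight_hom.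
rewrite [rows _ _]/= big_cat zero_rows [size _]/= exprS.
clearbody x c a; have {f0 zero_rows IHvs} := (IH true true, IH true false, IH false true, IH false false).
case: h v sign_rows => [] [] sign_rows; rewrite ?eqxx ?sign_rows ?big_nil /=
  ?(mul0r, add0r, addr0, mul1r) ?[a ^+ (size vs).+1]exprS => -[[[I1 I2] I3] I4].
- by rewrite mulrDr !(mulrCA a) I1 I4; field.
- by rewrite mulrCA I3; ring.
- by rewrite mulrCA I2; ring.
- by rewrite mulrDr !(mulrCA a) I4 I1; ring.
Qed.

Lemma square_hom k n s : size s = n ->
  a ^+ k * square Q (nseq k t) (nseq n t) s
  = (a ^+ n * c) ^+ k * \sum_(A <- square_arrays k s) x ^+ array_minus_count A.
Proof.
elim: k s => [|k IHk] s sz; rewrite ?expr0 ?mul1r.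
  rewrite /= size_nseq sz; case: eqP => _; rewrite ?big_nil // big_seq1 /array_minus_count /=.
  by rewrite expr0.
rewrite [square _ _ _ _]/= size_nseq enterE -[s]cats0 -{1}sz exprSr -mulrA line_hom; last first.
  by move=> p sp; rewrite leaveE ?sp // mul0r.
rewrite cats0 sz mulrCA [in RHS]exprS -[RHS]mulrA; congr (_ * _).
rewrite [square_arrays _ _]/= big_allpairs_dep !big_distrr; apply: eq_big_seq => r rin /=.
have szr : size (step s r) = n by rewrite size_map size_zip (size_rows rin) sz minnn.
rewrite leaveE // mul1r mulrCA IHk // mulrCA; congr (_ * _).
by rewrite big_distrr; apply: eq_bigr => A _; rewrite /array_minus_count /= exprD.
Qed.

Lemma size_middle b s b' : middle (b :: rcons s b') = s.
Proof. by rewrite /middle -rcons_cons rev_rcons /= revK. Qed.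

Lemma sum_step h vs r : r \in rows h vs ->
  (count id (step vs r) + h = count id vs + 1)%N.
Proof.
elim: vs h r => [|v vs IHvs] h r; first by case: h; rewrite //= inE => /eqP->.
rewrite [rows _ _]/= mem_cat => /orP[/mapP[r' /IHvs eqr ->]|].
  by rewrite /= addbF -!addnA eqr.
case: eqP => // <- /mapP[r' /IHvs eqr ->] /=.
rewrite signr_eq0 addbT; rewrite -/(step vs r'); case: (h) eqr => /=; lia.
Qed.

(** A wall contributes [a * t] if the column bit it absorbs is true, and [a] if it is false. Each
    row makes one more bit true by [sum_step], so [count id s + k] true bits leave the triangle; the
    one at the centre meets no wall, whence the extra [t] on the left. *)
Lemma triangle_hom k s : size s = k.*2.+1 ->
  a ^+ k * (t * triangle Q t t (fun m => m%:R) (nseq k t) s)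
  = t ^+ (count id s + k) * (\prod_(i < k) (a ^+ i.*2.+3 * c))
    * \sum_(A <- triangle_arrays k s) x ^+ array_minus_count A.
Proof.
elim: k s => [|k IHk] s sz.
  case: s sz => [|m [|]] // _; rewrite big_ord0 /=.
  by case: m; rewrite /= ?big_nil ?big_seq1 /array_minus_count //=; ring.
case: s sz => // v0 s; elim/last_ind: s => // s v1 _ [].
rewrite size_rcons doubleS => -[sz].
rewrite [triangle _ _ _ _ _]/= [triangle_arrays _ _]/= size_middle size_nseq.
have revn : nseq k t ++ t :: rev (nseq k t) = nseq (size s) t.
  have -> : rev (nseq k t) = nseq k t.
    by apply: (@eq_from_nth _ t); rewrite size_rev // => i; rewrite size_nseq => ik;
      rewrite nth_rev ?size_nseq // !nth_nseq !if_same.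
  by rewrite -[t :: _]/(nseq k.+1 t) -nseqD sz; congr nseq; lia.
have turn_leftE (b : bool) f (r' : seq bool) : turn_left Q t t f (b :: r') = t ^+ b * a * f (false :: r').
  by rewrite /turn_left /op /op0 /= drop0 /a /t /Q; case: b; rewrite /= ?expr1 ?expr0; field; rewrite ?q0.
have turn_rightE p (b b' : bool) f : size p = k.*2.+1 ->
    turn_right Q t t k.*2.+1 f (p ++ [:: b; b']) = (if b then t ^+ b' * a else 0) * f p.
  move=> <-; rewrite -[size p]addn0 /turn_right op_cat /op /op0 /= cats0 /a /t /Q.
  by case: b b' => [] []; rewrite /= ?expr1 ?expr0; field; rewrite ?q0.
rewrite turn_leftE revn -cats1.
set f := turn_right _ _ _ _ _.
have key := @line_hom f false s [:: v1].
have {key} key : a * line Q t (nseq (size s) t) 0 f (false :: s ++ [:: v1])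
    = a ^+ size s * c * \sum_(r <- rows false s) x ^+ minus_count r * f (step s r ++ [:: true; v1]).
  by apply: key => p sp; rewrite /f turn_rightE ?mul0r // sp.
rewrite big_ord_recr /= exprSr.
transitivity (a ^+ k * t * t ^+ v0 * a * (a * line Q t (nseq (size s) t) 0 f (false :: s ++ [:: v1]))).
  by ring.
rewrite key big_allpairs_dep !big_distrr; apply: eq_big_seq => r rin /=.
have szr : size (step s r) = k.*2.+1 by rewrite size_map size_zip (size_rows rin) minnn.
rewrite /f turn_rightE //.
transitivity (a * t ^+ v0 * (a ^+ size s * c) * x ^+ minus_count r * t ^+ v1 * a
   * (a ^+ k * (t * triangle Q t t (fun m => m%:R) (nseq k t) (step s r)))); first by ring.
rewrite IHk // count_cat /=.
have -> : (v0 + (count id s + (v1 + 0)) + k.+1 = v0 + v1 + (count id (step s r) + k))%N.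
  by have := sum_step rin; lia.
rewrite -[count _ _]/(count id (step s r)) !exprD sz.
rewrite [in RHS](eq_bigr (fun A => x ^+ minus_count r * x ^+ array_minus_count A)); last first.
  by move=> A _; rewrite /array_minus_count /= exprD.
rewrite -big_distrr /= -[k.*2.+3]addn2 !exprD; ring.
Qed.

End Weights.
End RowLists.

(** * Equality of the array counts *)

Section Counting.

Local Open Scope ring_scope.

Notation vac n := (nseq n false).

Lemma sum_arrays (F : numFieldType) (q : F) n (x := (q ^+ 2 + 1) ^+ 2 / q ^+ 2) :
    q != 0 -> q ^+ 8 != 1 ->
  \sum_(A <- triangle_arrays n.+1 (vac n.+1.*2.+1)) x ^+ array_minus_count A
  = \sum_(A <- square_arrays n.+1 (vac n.+1)) x ^+ array_minus_count A.
Proof.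
move=> q0 q8; have q4 : q ^+ 4 != 1.
  by apply: contraNneq q8 => q4; rewrite -[8%N]/(4 * 2)%N exprM q4 expr1n.
pose Q := q ^+ 2; pose t := q^-1.
have Q0 : Q != 0 by rewrite expf_neq0.
have Q4 : Q ^+ 4 != 1 by rewrite -exprM.
have t0 : t != 0 by rewrite invr_eq0.
have a0 := a_neq0 q4; set a := q ^+ 2 - 1 in a0.
have c0 : Q ^+ 2 - 1 != 0 by rewrite subr_eq0 -exprM.
set c := Q ^+ 2 - 1 in c0.
have tri := triangle_hom q0 q4 (size_nseq n.+1.*2.+1 false).
have sq := square_hom q0 q4 n.+1 (size_nseq n.+1 false).
rewrite triangle_square_homogeneous // count_nseq mul0n add0n -/Q -/t -/x -/a -/c in tri.
rewrite -/Q -/t -/x -/a -/c in sq.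
have prodE m : \prod_(i < m) (a ^+ i.*2.+3 * c) = a ^+ (m * m + m * 2) * c ^+ m.
  elim: m => [|m IHm]; first by rewrite big_ord0 !expr0 mulr1.
  rewrite big_ord_recr /= {}IHm mulrACA -exprD -exprSr; congr (_ ^+ _ * _).
  by rewrite mulnS mulSn; lia.
(* The common prefactor of both sums, each line having the proportionality factor [a ^+ 2] by
   [qq]. *)
pose d := t ^+ n.+1 * a ^+ (n.+1 * 2) * (a ^+ n.+1 * c) ^+ n.+1.
have d0 : d != 0.
  have ac0 : a ^+ n.+1 * c != 0 by rewrite mulf_neq0 // expf_neq0.
  exact: (mulf_neq0 (mulf_neq0 (expf_neq0 _ t0) (expf_neq0 _ a0)) (expf_neq0 _ ac0)).
have qq : (Q ^+ 2 * (t * t) - 1) * (Q * (1 - t * t)) = a ^+ 2.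
  by rewrite /Q /t /a; field.
apply: (mulfI d0); transitivity (t ^+ n.+1 * \prod_(i < n.+1) (a ^+ i.*2.+3 * c)
    * \sum_(A <- triangle_arrays n.+1 (vac n.+1.*2.+1)) x ^+ array_minus_count A).
  by rewrite prodE /d exprMn -exprM exprD; ring.
rewrite -tri qq /d -[RHS]mulrA -sq -exprM (mulnC 2) (exprS t); ring.
Qed.

Lemma count_arrays m n :
  count (fun A => array_minus_count A == m) (triangle_arrays n.+1 (vac n.+1.*2.+1))
  = count (fun A => array_minus_count A == m) (square_arrays n.+1 (vac n.+1)).
Proof.
pose P (L : seq (seq (seq int))) : {poly rat} := \sum_(A <- L) 'X^(array_minus_count A).
have coefP L : (P L)`_m = (count (fun A => array_minus_count A == m) L)%:R.
  rewrite coef_sum -sum1_count natr_sum [RHS]big_mkcond; apply: eq_bigr => A _ /=.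
  by rewrite coefXn eq_sym; case: eqP.
pose p := P (triangle_arrays n.+1 (vac n.+1.*2.+1)) - P (square_arrays n.+1 (vac n.+1)).
suff p0 : p = 0.
  by apply/eqP; rewrite -(eqr_nat rat) -!coefP (subr0_eq p0).
(* The nodes are [q = 2, 3, ...]: integers above 1 satisfy [q ^+ 8 != 1], and [q + 1 / q] is
   injective on them. *)
pose x (i : nat) : rat := let q := i.+2%:R in (q ^+ 2 + 1) ^+ 2 / q ^+ 2.
apply: (@roots_geq_poly_eq0 _ p (map x (iota 0 (size p)))); last by rewrite size_map size_iota.
  apply/allP => _ /mapP[i _ ->]; rewrite /root /p hornerD hornerN !horner_sum subr_eq0.
  under eq_bigr do rewrite hornerXn.
  under [X in _ == X]eq_bigr do rewrite hornerXn.
  apply/eqP; apply: sum_arrays; first by rewrite pnatr_eq0.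
  by rewrite -natrX -[1]/(1%:R) eqr_nat -[1%N](exp1n 8) eqn_exp2r.
rewrite map_inj_uniq ?iota_uniq // => i j /eqP.
rewrite /x /= eqr_div ?expf_neq0 ?pnatr_eq0 //.
rewrite -[1]/(1%:R) -!natrX -!natrD -!natrX -!natrM eqr_nat -!expnMn eqn_exp2r //.
move=> {P coefP p x m n} /eqP ij; suff: i.+2 = j.+2 by case.
move: i.+2 j.+2 (isT : 1 < i.+2)%N (isT : 1 < j.+2)%N ij => a b a1 b1 ab.
by case: (ltngtP a b) => // lt; nia.
Qed.

End Counting.

(** * Alternating sign lines and matrices *)

Section Lines.

Implicit Types (h v : bool) (vs : seq bool) (r s : seq int).

(* [run h s] reads [s] from the partial sum [h], failing when it leaves {0, 1}. *)
Fixpoint run h s : option bool :=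
  if s is x :: s' then
    if x == 0%R then run h s' else if x == ((-1) ^+ h)%R then run (~~ h) s' else None
  else Some h.

Lemma run_cat h s s' : run h (s ++ s') = obind (run^~ s') (run h s).
Proof. by elim: s h => //= x s IHs h; do 2?case: ifP. Qed.

Lemma run_sum h s h' : run h s = Some h' -> (h%:R + \sum_(x <- s) x = h'%:R :> int)%R.
Proof.
elim: s h => [|x s IHs] h /=; first by case=> ->; rewrite big_nil addr0.
rewrite big_cons; case: eqP => [-> /IHs <-|_]; first by rewrite add0r.
by case: eqP => // -> /IHs <-; case: h => /=; ring.
Qed.

(** Read backwards, the partial sums are replaced by one minus themselves. *)
Lemma run_rev h s h' : run h s = Some h' -> run (~~ h') (rev s) = Some (~~ h).
Proof.
elim: s h => [|x s IHs] h /=; first by case=> ->.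
rewrite rev_cons -cats1 run_cat.
case: eqP => [-> /IHs -> //|/eqP x0].
case: eqP => // xE /IHs -> /=; rewrite (negPf x0) negbK xE.
by case: h {xE}.
Qed.

Definition opposites := fun x y : int => (y == - x)%R.

Lemma path_opposites_sum (x : int) s : path opposites x s ->
  (\sum_(y <- s) y = 0 \/ \sum_(y <- s) y = - x)%R.
Proof.
elim: s x => [|y s IHs] x /=; first by left; rewrite big_nil.
case/andP=> /eqP-> /IHs; rewrite opprK big_cons => -[] ->; [right|left]; lia.
Qed.

(** A partial sum [h] acts like a preceding non-zero entry: 1 if it is true, -1 if it is false. *)
Lemma run_path h s :
  isSome (run h s) = path opposites ((-1) ^+ ~~ h)%R [seq x <- s | x != 0%R].
Proof.
elim: s h => //= x s IHs h; case: eqP => [->|/eqP x0] //=.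
have -> : ((-1) ^+ h = - (-1) ^+ (~~ h) :> int)%R by case: h.
rewrite /opposites; case: eqP => // xE; rewrite IHs negbK xE.
by case: h {xE}.
Qed.

Lemma sum_nonzero s : (\sum_(x <- [seq x <- s | x != 0%R]) x = \sum_(x <- s) x)%R.
Proof.
by rewrite big_filter big_mkcond; apply: eq_bigr => x _; case: eqP => // ->.
Qed.

Lemma asm_line_run s : asm_line s = (run false s == Some true).
Proof.
have runP : run false s = Some true <-> isSome (run false s) /\ (\sum_(x <- s) x = 1)%R.
  case E: (run false s) => [h'|]; last by split=> [|[]].
  by have := run_sum E; rewrite add0r => ->; case: h' {E} => //=; split=> [|[_]].
rewrite /asm_line /alternating; apply/andP/eqP => [[]|runs].
  move=> alt /eqP sum1; apply/runP; split=> //; rewrite run_path /=.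
  move: alt sum1; rewrite -sum_nonzero; case: [seq x <- s | _] => [|x l]; first by rewrite big_nil.
  (* An alternating list starting with [x] has sum 0 or [x], so the sum 1 forces [x = 1]. *)
  rewrite big_cons /= => xl; case: (path_opposites_sum xl) => -> // sum1; last by lia.
  by rewrite xl andbT /opposites; lia.
have [] := runP.1 runs; rewrite run_path => /path_sorted alt ->.
by split.
Qed.

(* [r] may follow the partial column sums [vs]: every entry keeps its column sum in {0, 1}. *)
Lemma mem_rows h vs r : (r \in rows h vs) =
  [&& size r == size vs, run h r == Some true
    & all (fun p => isSome (run p.1 [:: p.2])) (zip vs r)].
Proof.
elim: vs h r => [|v vs IHvs] h [|x r] //=.
- by case: h.
- by case: h; rewrite ?inE // in_nil.
- rewrite mem_cat; apply/negbTE/negP => /orP[/mapP[] //|].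
  by case: ifP => // _ /mapP[].
rewrite mem_cat eqSS.
have -> : (x :: r \in [seq 0%R :: r | r <- rows h vs]) = (x == 0%R) && (r \in rows h vs).
  by apply/mapP/andP => [[r' r'in [-> ->]] //|[/eqP-> rin]]; exists r.
have -> : (x :: r \in (if h == v then [seq ((-1) ^+ h)%R :: r | r <- rows (~~ h) vs] else [::]))
    = [&& h == v, x == ((-1) ^+ h)%R & r \in rows (~~ h) vs].
  case: ifP => //= _.
  by apply/mapP/andP => [[r' r'in [-> ->]] //|[/eqP-> rin]]; exists r.
rewrite !IHvs; case: eqP => [->|/eqP x0] /=.
  by rewrite [X in _ || X](_ : _ = false) ?orbF //; case: h; rewrite ?andbF.
case: (x =P ((-1) ^+ h)%R) => [xE|] /=; last by rewrite !andbF.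
case: (h =P v) => [<-|hv] /=; first by rewrite xE eqxx.
have -> : (x == ((-1) ^+ v)%R) = false by rewrite xE; case: h v hv {x0 xE} => [] [].
by rewrite !andbF.
Qed.

Lemma uniq_rows h vs : uniq (rows h vs).
Proof.
elim: vs h => [|v vs IHvs] h /=; first by case: h.
have cons_inj (x : int) : injective (cons x) by move=> r r' [].
rewrite cat_uniq map_inj_uniq // IHvs /=; case: ifP => // _.
rewrite map_inj_uniq // IHvs andbT; apply/hasPn => _ /mapP[r _ ->].
by apply/mapP => -[r' _ [] /eqP]; rewrite signr_eq0.
Qed.

End Lines.

(** * Arrays characterized by their rows and columns *)

Section Arrays.

Implicit Types (h v : bool) (vs s : seq bool) (r : seq int) (A : seq (seq int)).

Lemma run_cons v x r :
  run v (x :: r) = if isSome (run v [:: x]) then run (v (+) (x != 0%R)) r else None.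
Proof. by rewrite /=; case: eqP => _; [rewrite addbF | rewrite addbT; case: eqP]. Qed.

Lemma rowsP vs r : reflect
  [/\ size r = size vs, run false r = Some true
    & forall j, j < size vs -> isSome (run (nth false vs j) [:: nth 0%R r j])]
  (r \in rows false vs).
Proof.
rewrite mem_rows; apply: (iffP and3P) => [[/eqP sz /eqP runr /(all_nthP (false, 0%R)) ok]|[sz runr ok]].
  split=> // j jlt; have := ok j; rewrite size_zip sz minnn jlt nth_zip //.
  by move=> /(_ isT).
split; [exact/eqP | exact/eqP |].
apply/(all_nthP (false, 0%R)) => j; rewrite size_zip sz minnn => jlt.
by rewrite nth_zip //; apply: ok.
Qed.

Lemma size_step vs r : size r = size vs -> size (step vs r) = size vs.
Proof. by move=> sz; rewrite size_map size_zip sz minnn. Qed.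

Lemma nth_step vs r j : size r = size vs -> j < size vs ->
  nth false (step vs r) j = nth false vs j (+) (nth 0%R r j != 0%R).
Proof.
move=> sz jlt; rewrite (nth_map (false, 0%R)) ?size_zip ?sz ?minnn // nth_zip //.
Qed.

Lemma square_arraysP k s A : reflect
  [/\ size A = k, (forall r, r \in A -> size r = size s /\ run false r = Some true)
    & forall j, j < size s -> run (nth false s j) [seq nth 0%R r j | r <- A] = Some true]
  (A \in square_arrays k s).
Proof.
elim: k s A => [|k IHk] s A.
  rewrite /=; case: eqP => [sE|sN]; last first.
    constructor=> -[/size0nil -> _ ok]; apply: sN.
    apply: (@eq_from_nth _ false); rewrite ?size_nseq // => j jlt.
    by have := ok j jlt; rewrite nth_nseq jlt /= => -[].
  rewrite inE; apply: (iffP eqP) => [->|[/size0nil //]].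
  by split=> // j jlt; rewrite sE nth_nseq; rewrite jlt.
apply: (iffP allpairsPdep) => [[r [B [/rowsP[szr runr okr] /IHk[szB rB cB] ->]]]|].
  rewrite size_step // in rB cB; split=> [|r'|j jlt]; first by rewrite /= szB.
    by rewrite inE => /predU1P[->|/rB].
  by rewrite map_cons run_cons okr // -nth_step // cB.
case: A => [|r A] [] // [szA] rA cA.
have [szr runr] := rA r (mem_head _ _).
have okr j : j < size s -> isSome (run (nth false s j) [:: nth 0%R r j]).
  by move=> jlt; have := cA j jlt; rewrite map_cons run_cons; case: ifP.
exists r, A; split=> //; first exact/rowsP.
apply/IHk; rewrite size_step //; split=> // [r' r'A|j jlt]; first by apply: rA; rewrite inE r'A orbT.
by have := cA j jlt; rewrite map_cons run_cons okr // nth_step.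
Qed.

Lemma uniq_square_arrays k s : uniq (square_arrays k s).
Proof.
elim: k s => [|k IHk] s /=; first by case: ifP.
apply: allpairs_uniq_dep => [|r _|]; [exact: uniq_rows | exact: IHk |].
by move=> [r A] [r' A'] _ _ /= [-> ->].
Qed.

Lemma uniq_triangle_arrays k s : uniq (triangle_arrays k s).
Proof.
elim: k s => [|k IHk] s /=; first by case: ifP.
apply: allpairs_uniq_dep => [|r _|]; [exact: uniq_rows | exact: IHk |].
by move=> [r A] [r' A'] _ _ /= [-> ->].
Qed.

(* The entries of column [j] of a triangle with rows of lengths [2k - 1, ..., 3, 1], the columns
   being numbered from 0 to [2k]. *)
Definition triangle_column k j A :=
  [seq nth 0%R (nth [::] A i) (j - i.+1) | i <- iota 0 (minn j (k.*2 - j))].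

Lemma triangle_column_cons k j r A : j <= k.*2 ->
  triangle_column k.+1 j.+1 (r :: A) = nth 0%R r j :: triangle_column k j A.
Proof.
move=> jle; rewrite /triangle_column.
have -> : minn j.+1 (k.+1.*2 - j.+1) = (minn j (k.*2 - j)).+1 by lia.
rewrite /= subSS subn0; congr (_ :: _).
rewrite -[1]/(1 + 0) iotaDl -map_comp; apply: eq_map => i /=.
by rewrite subSS.
Qed.

Lemma size_middle_nth s n j : size s = n.+2 -> j < n ->
  size (middle s) = n /\ nth false (middle s) j = nth false s j.+1.
Proof.
case: s => // b s; elim/last_ind: s => // s b' _; rewrite /= size_rcons => -[sz] jlt.
by rewrite size_middle sz nth_rcons sz jlt.
Qed.

(** A column other than the central one may stop at either partial sum, because the diagonal entry
    below it is not part of the array. *)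
Lemma triangle_arraysP k s A : size s = k.*2.+1 -> reflect
  [/\ size A = k,
      (forall i, i < k ->
         size (nth [::] A i) = (k - i).*2.-1 /\ run false (nth [::] A i) = Some true),
      (forall j, j <= k.*2 -> isSome (run (nth false s j) (triangle_column k j A)))
    & run (nth false s k) (triangle_column k k A) = Some true]
  (A \in triangle_arrays k s).
Proof.
elim: k s A => [|k IHk] s A szs.
  case: s szs => [|b [|]] // _ /=; case: b => /=; last first.
    by constructor=> -[].
  by rewrite inE; apply: (iffP eqP) => [->|[/size0nil //]]; split=> // j; rewrite leqn0 => /eqP->.
have szm : size (middle s) = k.*2.+1 by have [] := @size_middle_nth s k.*2.+1 0 szs isT.
have nthm j : j < k.*2.+1 -> nth false (middle s) j = nth false s j.+1.
  by move=> jlt; have [] := @size_middle_nth s k.*2.+1 j szs jlt.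
have column_run r B j : size r = k.*2.+1 -> j <= k.*2 ->
    (isSome (run (nth false (middle s) j) [:: nth 0%R r j])) ->
    run (nth false s j.+1) (triangle_column k.+1 j.+1 (r :: B))
    = run (nth false (step (middle s) r) j) (triangle_column k j B).
  by move=> szr jle ok; rewrite triangle_column_cons // run_cons -nthm // ok nth_step ?szm ?szr.
apply: (iffP allpairsPdep) => [[r [B [/rowsP[szr runr okr] inB ->]]]|].
  rewrite szm in szr okr.
  have := IHk (step (middle s) r) B; rewrite size_step ?szm // => /(_ erefl) PB.
  case/PB: inB => szB rB cB mB; split=> [|[|i] ilt|j jle|].
  - by rewrite /= szB.
  - by rewrite subn0 /= szr.
  - by rewrite /= subSS; apply: rB.
  - case: j jle => [|j jle]; first by rewrite /triangle_column min0n.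
    case: (leqP j k.*2) => jk; first by rewrite column_run ?okr ?cB.
    (* The last column, like the first, has no interior entry. *)
    have -> : triangle_column k.+1 j.+1 (r :: B) = [::] => //.
    by rewrite /triangle_column (_ : minn _ _ = 0) //; lia.
  - by rewrite column_run ?okr //; lia.
case: A => [|r A] [] // [szA] rA cA mA.
have [szr runr] := rA 0 isT; rewrite subn0 /= in szr runr.
have okr j : j < k.*2.+1 -> isSome (run (nth false (middle s) j) [:: nth 0%R r j]).
  move=> jlt; have /cA : j.+1 <= k.+1.*2 by lia.
  by rewrite triangle_column_cons // run_cons -nthm //; case: ifP.
exists r, A; split=> //; first by apply/rowsP; rewrite szm.
have := IHk (step (middle s) r) A; rewrite size_step ?szm // => /(_ erefl) PA.
apply/PA; split=> // [i ilt|j jle|].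
- by have := rA i.+1 ilt; rewrite /= subSS.
- by rewrite -column_run ?okr ?cA //; lia.
- by rewrite -column_run ?okr //; lia.
Qed.

End Arrays.

Lemma card_count (T : finType) (X : eqType) (S : {set T}) (f : T -> X) (l : seq X) (P : pred X) :
  uniq l -> {in S &, injective f} -> (forall y, y \in l <-> exists2 x, x \in S & y = f x) ->
  #|[set x in S | P (f x)]| = count P l.
Proof.
move=> ul inj lP; rewrite cardE -(size_map f) -size_filter.
apply: perm_size; apply: uniq_perm; last 1 first.
- move=> y; rewrite mem_filter; apply/mapP/andP => [[x]|[Py /lP[x xS yE]]].
    by rewrite mem_enum inE => /andP[xS Px] ->; split=> //; apply/lP; exists x.
  by exists x => //; rewrite mem_enum inE xS -yE.
- rewrite map_inj_in_uniq ?enum_uniq // => x x'; rewrite !mem_enum !inE.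
  by move=> /andP[xS _] /andP[x'S _]; apply: inj.
- exact: filter_uniq.
Qed.

(** * Alternating sign matrices as square arrays *)

Section Matrices.

Implicit Types (s : seq bool) (r : seq int) (L : seq (seq int)).

Lemma run_entries h r : isSome (run h r) -> {subset r <= [:: 0%R; 1%R; (-1)%R]}.
Proof.
elim: r h => //= x r IHr h runr y; rewrite inE => /predU1P[->|].
  by move: runr; case: eqP => [->//|_]; case: eqP => // -> _; case: h.
by move: runr; case: eqP => [_|_]; [|case: eqP => // _]; move=> /IHr; apply.
Qed.

Lemma int_mx_inj m : injective (@int_mx m).
Proof.
move=> A B /matrixP AB; apply/matrixP => i j; apply: val_inj.
by have := AB i j; rewrite !mxE.
Qed.

Lemma int_mx_onto m (M : 'M[int]_m) :
  (forall i j, M i j \in [:: 0%R; 1%R; (-1)%R]) -> exists A : 'M[entry]_m, int_mx A = M.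
Proof.
move=> MP; exists (\matrix_(i, j) SeqSub (MP i j) : 'M[entry]_m)%R.
by apply/matrixP => i j; rewrite !mxE.
Qed.

Definition matrix_rows m (M : 'M[int]_m) := [seq row_seq M i | i <- enum 'I_m].

Lemma size_row_seq m (M : 'M[int]_m) i : size (row_seq M i) = m.
Proof. by rewrite size_map size_enum_ord. Qed.

Lemma nth_row_seq m (M : 'M[int]_m) i (j : 'I_m) : nth 0%R (row_seq M i) j = M i j.
Proof. by rewrite (nth_map j) ?size_enum_ord // nth_ord_enum. Qed.

Lemma nth_matrix_rows m (M : 'M[int]_m) (i : 'I_m) : nth [::] (matrix_rows M) i = row_seq M i.
Proof. by rewrite (nth_map i) ?size_enum_ord // nth_ord_enum. Qed.

Lemma matrix_rows_inj m : injective (@matrix_rows m).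
Proof.
move=> M M' MM'; apply/matrixP => i j.
by rewrite -!nth_row_seq -!nth_matrix_rows MM'.
Qed.

Lemma matrix_rows_column m (M : 'M[int]_m) (j : 'I_m) :
  [seq nth 0%R r j | r <- matrix_rows M] = col_seq M j.
Proof. by rewrite -map_comp; apply: eq_map => i; rewrite /= nth_row_seq. Qed.

Lemma ASM_square m (A : 'M[entry]_m) :
  (A \in ASM m) = (matrix_rows (int_mx A) \in square_arrays m (nseq m false)).
Proof.
rewrite inE; apply/andP/square_arraysP => [[/forallP rA /forallP cA]|[_ rA cA]].
  split=> [|_ /mapP[i _ ->]|j]; first by rewrite size_map size_enum_ord.
    by rewrite size_row_seq size_nseq; have := rA i; rewrite asm_line_run => /eqP.
  rewrite size_nseq nth_nseq => jlt; rewrite jlt.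
  by have := cA (Ordinal jlt); rewrite asm_line_run -matrix_rows_column => /eqP.
split; apply/forallP => i; rewrite asm_line_run; apply/eqP.
  by have [|] := rA (row_seq (int_mx A) i); first by apply: map_f; rewrite mem_enum.
by rewrite -matrix_rows_column; have := cA i; rewrite size_nseq nth_nseq ltn_ord; apply.
Qed.

Lemma array_minus_countE L : array_minus_count L = \sum_(r <- L) \sum_(x <- r) (x == -1)%R.
Proof.
rewrite /array_minus_count sumnE big_map; apply: eq_bigr => r _.
by rewrite /minus_count -sum1_count big_mkcond; apply: eq_bigr => x _; rewrite /=; case: (x == _).
Qed.

Lemma mu_matrix_rows m (A : 'M[entry]_m) : mu A = array_minus_count (matrix_rows (int_mx A)).
Proof.
rewrite array_minus_countE big_map big_enum /=.
under eq_bigr do rewrite big_map big_enum /=.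
rewrite pair_big /mu /minus_ones /= -sum1_card big_mkcond /=.
by apply: eq_bigr => p _; rewrite !inE; case: (_ == _).
Qed.

Lemma square_matrix m L : L \in square_arrays m (nseq m false) ->
  exists A : 'M[entry]_m, L = matrix_rows (int_mx A).
Proof.
case/square_arraysP; rewrite size_nseq => szL rL cL.
have Lij (i j : 'I_m) : nth 0%R (nth [::] L i) j \in [:: 0%R; 1%R; (-1)%R].
  have [|szr runr] := rL (nth [::] L i); first by rewrite mem_nth // szL.
  by apply: (@run_entries false (nth [::] L i)); rewrite ?runr // mem_nth // szr.
pose M : 'M[int]_m := (\matrix_(i, j) nth 0 (nth [::] L i) j)%R.
have [|A AM] := @int_mx_onto _ M; first by move=> i j; rewrite mxE.
exists A; rewrite AM; apply: (@eq_from_nth _ [::]); first by rewrite size_map size_enum_ord.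
rewrite szL => i ilt; rewrite (nth_matrix_rows M (Ordinal ilt)).
have [|szr _] := rL (nth [::] L i); first by rewrite mem_nth // szL.
apply: (@eq_from_nth _ 0%R); rewrite ?size_row_seq szr // => j jlt.
by rewrite (nth_row_seq M (Ordinal ilt) (Ordinal jlt)) mxE.
Qed.

Lemma card_ASM m n :
  #|[set A in ASM n | mu A == m]|
  = count (fun L => array_minus_count L == m) (square_arrays n (nseq n false)).
Proof.
rewrite -(card_count (S := ASM n) (f := fun A => matrix_rows (int_mx A))).
- by apply: eq_card => A; rewrite !inE mu_matrix_rows.
- exact: uniq_square_arrays.
- by move=> A B _ _ /matrix_rows_inj/int_mx_inj.
move=> L; split=> [Lin|[A]]; last by rewrite ASM_square => ? ->.
by have [A LA] := square_matrix Lin; exists A; rewrite // ASM_square -LA.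
Qed.

End Matrices.

(** * Doubly symmetric matrices and their fundamental triangles *)

Section Triangle.

Variable n : nat.
Local Notation N := n.*2.
Implicit Types (f : nat -> nat -> int) (L : seq (seq int)).

(** Matrices are handled as functions on natural numbers, of which only the indices up to [N]
    matter. *)
Definition symmetric_entries f := forall i j, i <= N -> j <= N ->
  f i j = f j i /\ f i j = f (N - j) (N - i).

Definition entry_line f i := [seq f i j | j <- iota 0 N.+1].
Definition upper_column f j := [seq f k j | k <- iota 0 (minn j (N - j))].
Definition interior_row f i := [seq f i j | j <- iota i.+1 (n - i).*2.-1].
Definition interior f := [seq interior_row f i | i <- iota 0 n].

Definition diagonal_entry f j := f (minn j (N - j)) j.

Definition balanced f := forall j, j <= N -> j != n ->
  diagonal_entry f j = (- \sum_(x <- upper_column f j) x)%R.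

Lemma rev_iota k m : rev (iota k m) = [seq k.*2 + m - i.+1 | i <- iota k m].
Proof.
apply: (@eq_from_nth _ 0) => [|i]; rewrite size_rev ?size_map // size_iota => im.
rewrite nth_rev ?size_iota // (nth_map 0) ?size_iota // !nth_iota //; lia.
Qed.

(** Reflection in the diagonal maps the first [i] entries of the row to the part of column [i] above
    the diagonal; reflection in the antidiagonal maps the last [i] to that of column [N - i],
    reversed. *)
Lemma entry_line_split f i : symmetric_entries f -> i < n ->
  entry_line f i = upper_column f i ++ diagonal_entry f i :: interior_row f i
                   ++ diagonal_entry f (N - i) :: rev (upper_column f (N - i)).
Proof.
move=> fS ilt; rewrite /entry_line /upper_column /diagonal_entry.
have -> : minn i (N - i) = i by lia.
have -> : minn (N - i) (N - (N - i)) = i by lia.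
have -> : N.+1 = i + ((n - i).*2.-1.+1 + i.+1) by lia.
rewrite iotaD map_cat; congr (_ ++ _).
  by apply/eq_in_map => k; rewrite mem_iota => /andP[_ kl]; case: (fS i k) => //; lia.
rewrite iotaD map_cat add0n /=; congr (_ :: _ ++ _).
have -> : i + (n - i).*2.-1.+1 = N - i by lia.
congr (_ :: _); rewrite -map_rev rev_iota -map_comp.
have -> : iota (N - i).+1 i = [seq (N - i).+1 + k | k <- iota 0 i] by rewrite -iotaDl addn0.
rewrite -map_comp; apply/eq_in_map => k; rewrite mem_iota => /andP[_ kl] /=.
have [|| _ ->] := fS i ((N - i).+1 + k); try lia.
by congr (f _ _); lia.
Qed.

Lemma entry_line_center f : symmetric_entries f ->
  entry_line f n = upper_column f n ++ f n n :: rev (upper_column f n).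
Proof.
move=> fS; rewrite /entry_line /upper_column.
have -> : minn n (N - n) = n by lia.
have -> : N.+1 = n + n.+1 by lia.
rewrite iotaD map_cat; congr (_ ++ _).
  by apply/eq_in_map => k; rewrite mem_iota => /andP[_ kl]; case: (fS n k) => //; lia.
rewrite add0n /=; congr (_ :: _); rewrite -map_rev rev_iota -map_comp.
have -> : iota n.+1 n = [seq n.+1 + k | k <- iota 0 n] by rewrite -iotaDl addn0.
rewrite -map_comp; apply/eq_in_map => k; rewrite mem_iota => /andP[_ kl] /=.
have [|| _ ->] := fS n (n.+1 + k); try lia.
by congr (f _ _); lia.
Qed.

Lemma nth_interior f i : i < n -> nth [::] (interior f) i = interior_row f i.
Proof. by move=> ilt; rewrite (nth_map 0) ?size_iota // nth_iota. Qed.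

Lemma nth_interior_row f i j : i < j -> j < N - i -> nth 0%R (interior_row f i) (j - i.+1) = f i j.
Proof.
move=> ij jN; rewrite (nth_map 0) ?size_iota; last by lia.
by rewrite nth_iota; [congr (f _ _) | ]; lia.
Qed.

Lemma triangle_column_interior f j : j <= N -> triangle_column n j (interior f) = upper_column f j.
Proof.
move=> jN; apply/eq_in_map => k; rewrite mem_iota => /andP[_ kl].
by rewrite nth_interior ?nth_interior_row //; lia.
Qed.

Lemma run_opposite h s b : run h s = Some b -> run h (rcons s (- b%:R)%R) = Some false.
Proof. by rewrite -cats1 run_cat => -> /=; case: b. Qed.

Lemma run_upper_column f j : balanced f -> j <= N -> j != n ->
  isSome (run false (upper_column f j)) ->
  run false (rcons (upper_column f j) (diagonal_entry f j)) = Some false.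
Proof.
move=> bal jN jn; rewrite bal //; case runE: (run _ _) => [b|] // _.
by have := run_sum runE; rewrite add0r => ->; apply: run_opposite runE.
Qed.

(* The part of row [i] outside the interior contributes a run from 0 to 0 on the left, and
   mirrored a run from 1 to 1 on the right. *)
Lemma run_entry_line f i : symmetric_entries f -> balanced f -> i < n ->
  isSome (run false (upper_column f i)) ->
  (run false (entry_line f i) == Some true) =
  isSome (run false (upper_column f (N - i))) && (run false (interior_row f i) == Some true).
Proof.
move=> fS bal ilt ok; rewrite entry_line_split // -cat_rcons run_cat.
rewrite run_upper_column // => [|| ] /=; [|lia|lia].
rewrite -rev_rcons run_cat; case ok': (run _ (upper_column f (N - i))) => [b|]; last first.
  rewrite andFb; apply/negbTE/negP; case: (run _ (interior_row _ _)) => // h.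
  rewrite /obind /oapp => /eqP/run_rev; rewrite revK -cats1 run_cat.
  by rewrite -[~~ true]/false ok'.
have runR : run false (rcons (upper_column f (N - i)) (diagonal_entry f (N - i))) = Some false.
  by rewrite run_upper_column ?ok' //; lia.
case: (run _ (interior_row _ _)) => //= h.
case: h; first by rewrite (run_rev runR) eqxx.
apply/negbTE/negP => /eqP/run_rev; rewrite revK => /=.
by rewrite runR.
Qed.

(** The central row is symmetric about its middle entry, which is therefore determined by the row
    sum. *)
Lemma run_entry_line_center f b : symmetric_entries f ->
  run false (upper_column f n) = Some b ->
  (run false (entry_line f n) == Some true) = (f n n == 1 - b%:R * 2)%R.
Proof.
move=> fS runE; rewrite entry_line_center //; have sumE := run_sum runE.
apply/eqP/eqP => [/run_sum|cE].
  rewrite add0r big_cat big_cons (perm_big _ (permEl (perm_rev _))) /=.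
  by move: (bigop _ _ _) sumE => c; case: (b) => /=; lia.
rewrite run_cat runE cE; have := run_rev runE.
by case: b {runE sumE cE} => /= runR; rewrite runR.
Qed.

End Triangle.

(** * Balance and the diagonal statistic *)

Section Balance.

Variable n : nat.
Local Notation N := n.*2.
Implicit Types (f : nat -> nat -> int) (L : seq (seq int)).

Lemma run_prefix h r r' : isSome (run h (r ++ r')) -> isSome (run h r).
Proof. by rewrite run_cat; case: (run h r). Qed.

Lemma run_diagonal f j : symmetric_entries n f ->
  (forall i, i <= n -> run false (entry_line n f i) = Some true) -> j <= N ->
  isSome (run false (rcons (upper_column n f j) (diagonal_entry n f j))).
Proof.
move=> fS lines jN; case: (ltngtP j n) => [jlt|jgt|->].
- have := lines j (ltnW jlt); rewrite entry_line_split // -cat_rcons.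
  by move/(congr1 isSome)/run_prefix.
- have ilt : N - j < n by lia.
  have := run_rev (lines _ (ltnW ilt)); rewrite entry_line_split // subKn //.
  rewrite -cat_rcons !catA -rev_rcons rev_cat revK.
  by move/(congr1 isSome)/run_prefix.
have := lines n (leqnn n); rewrite entry_line_center // -cat_rcons.
rewrite /diagonal_entry (_ : minn n (N - n) = n); last by lia.
by move/(congr1 isSome)/run_prefix.
Qed.

Lemma interior_triangle f : 0 < n -> symmetric_entries n f -> balanced n f ->
  (forall i, i <= n -> run false (entry_line n f i) = Some true) <->
  interior n f \in triangle_arrays n (nseq N.+1 false) /\ f n n = (-1)%R.
Proof.
move=> n0 fS bal.
have Tri := @triangle_arraysP n (nseq N.+1 false) (interior n f) (size_nseq _ _).
have nthv j : nth false (nseq N.+1 false) j = false by rewrite nth_nseq if_same.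
have szI i : i < n -> size (interior_row n f i) = (n - i).*2.-1.
  by rewrite size_map size_iota.
split=> [lines|[/Tri[_ rowI colI midI] center]].
  have cols j : j <= N -> isSome (run false (upper_column n f j)).
    by move=> jN; have := run_diagonal fS lines jN; rewrite -cats1 => /run_prefix.
  have rowI i : i < n -> run false (interior_row n f i) = Some true.
    move=> ilt; have iN : i <= N by lia.
    have := run_entry_line fS bal ilt (cols i iN).
    by rewrite lines ?eqxx 1?ltnW // => /esym/andP[_ /eqP].
  (* The last interior row has a single entry; it equals 1 and is the last one of the central
     column, which therefore ends at 1. *)
  have mid : run false (upper_column n f n) = Some true.
    have := rowI n.-1; rewrite prednK // => /(_ (leqnn _)).
    rewrite /interior_row (_ : (n - n.-1).*2.-1 = 1); last by lia.
    rewrite prednK //=; case: eqP => // _; case: eqP => // last1 _.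
    have := cols n; rewrite (_ : upper_column n f n = rcons [seq f k n | k <- iota 0 n.-1] (f n.-1 n)).
      rewrite -cats1 run_cat; case: (run _ _) => [b|] /=; last by move=> /(_ ltac:(lia)).
      by rewrite last1; case: b => /= [/(_ ltac:(lia))|].
    rewrite /upper_column (_ : minn n (N - n) = n.-1.+1); last by lia.
    by rewrite -addn1 iotaD map_cat cats1.
  have center : f n n = (-1)%R.
    have := run_entry_line_center fS mid; rewrite lines // eqxx => /esym/eqP->.
    by [].
  split=> //; apply/Tri; split.
  - by rewrite size_map size_iota.
  - by move=> i ilt; rewrite nth_interior // szI // rowI.
  - by move=> j jN; rewrite nthv triangle_column_interior // cols.
  - by rewrite nthv triangle_column_interior //; lia.
have mid : run false (upper_column n f n) = Some true.
  by rewrite -(nthv n) -triangle_column_interior //; lia.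
have cols j : j <= N -> isSome (run false (upper_column n f j)).
  by move=> jN; rewrite -triangle_column_interior // -(nthv j) colI.
move=> i; rewrite leq_eqVlt => /predU1P[->|ilt]; apply/eqP.
  by rewrite (run_entry_line_center fS mid) center.
rewrite run_entry_line ?cols //; [|lia|lia].
by have := rowI i ilt; rewrite nth_interior // => -[_ ->].
Qed.

Lemma sum_fold (V : nmodType) (h : nat -> V) :
  (\sum_(j < N.+1) h j = \sum_(i < n) (h i + h (N - i)%N) + h n)%R.
Proof.
rewrite -(big_mkord xpredT) (@big_cat_nat _ _ _ n) //=; last by lia.
rewrite [X in (_ + X)%R]big_ltn; last by lia.
rewrite big_split /= big_mkord -!addrA [(h n + _)%R]addrC; congr (_ + (_ + _))%R.
rewrite -[n.+1]add0n big_addn (_ : N.+1 - n.+1 = n); last by lia.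
rewrite big_mkord (reindex_inj rev_ord_inj); apply: eq_bigr => i _ /=.
by congr h; have := ltn_ord i; lia.
Qed.

Lemma sum_interior f :
  (\sum_(i < n) \sum_(x <- interior_row n f i) x = \sum_(j < N.+1) \sum_(x <- upper_column n f j) x)%R.
Proof.
transitivity (\sum_(0 <= i < n) \sum_(0 <= j < N.+1 | ((i < j) && (j < N - i))%N) f i j)%R.
  rewrite big_mkord; apply: eq_bigr => i _; rewrite big_map.
  have -> : iota i.+1 (n - i).*2.-1 = index_iota i.+1 (N - i).
    by rewrite /index_iota; congr iota; have := ltn_ord i; lia.
  rewrite (big_nat_widen _ _ N.+1) /=; last by lia.
  by rewrite (big_nat_widenl _ 0) //; apply: eq_bigl => j; rewrite andbC.
rewrite (exchange_big_dep_nat xpredT) //= big_mkord; apply: eq_bigr => j _.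
rewrite big_map; have -> : iota 0 (minn j (N - j)) = index_iota 0 (minn j (N - j)) by rewrite /index_iota subn0.
rewrite [RHS](big_nat_widen _ _ n).
  by apply: eq_bigl => i; have := ltn_ord j; lia.
by have := ltn_ord j; lia.
Qed.

Lemma center_sum (x : int) (b : bool) :
  (b%:R + (x + b%:R) = 1 -> (x == -1)%:R = b%:R :> int)%R.
Proof.
case: b => /=; first by move=> xE; have -> : x = (-1)%R by lia.
by rewrite add0r addr0 => ->.
Qed.

Lemma balanced_count f : symmetric_entries n f ->
  (forall i, i <= n -> run false (entry_line n f i) = Some true) ->
  balanced n f <-> \sum_(j < N.+1) (diagonal_entry n f j == -1)%R = n.
Proof.
move=> fS lines.
pose c j : int := (\sum_(x <- upper_column n f j) x)%R.
pose d := diagonal_entry n f.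
pose e j : int := (d j == -1)%R%:R%R.
pose h j : int := (c j * 2 + d j - e j)%R.
have cd j : j <= N -> exists b : bool, c j = b%:R%R /\ (d j = 0 \/ d j = (-1) ^+ b)%R.
  move=> jN; have := run_diagonal fS lines jN; rewrite -cats1 run_cat.
  case runE: (run _ _) => [b|] //= ok; exists b.
  have := run_sum runE; rewrite add0r; split=> //.
  by move: ok; rewrite -/d; case: eqP => [->|_]; [left | case: eqP => // ->; right].
(* The pairs [(c j, d j)] can be (0, 0), (0, 1), (1, 0) and (1, -1), with [h j] equal to 0, 1, 2 and
   0. *)
have h0 j : j <= N -> (0 <= h j)%R /\ (h j = 0 <-> d j = - c j)%R.
  by move=> jN; rewrite /h /e; have [[] [-> [] ->]] := cd j jN.
have minn_n : minn n (N - n) = n by lia.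
(* The central row gives [2 * c n + d n = 1], so the centre is -1 exactly when [c n = 1]. *)
have en : e n = c n.
  have := run_sum (lines n (leqnn n)); rewrite entry_line_center // big_cat big_cons /=.
  rewrite (perm_big _ (permEl (perm_rev _))) /= -/(c n) /e /d /diagonal_entry minn_n.
  have nN : n <= N by lia.
  have [b [-> _]] := cd n nN.
  by rewrite add0r; apply: center_sum.
have rowE (i : 'I_n) : (\sum_(x <- interior_row n f i) x
    = 1 - (c i + d i + d (N - i)%N + c (N - i)%N))%R.
  have := run_sum (lines i (ltnW (ltn_ord i))); rewrite entry_line_split // add0r.
  rewrite !big_cat /= !big_cons big_cat big_cons /= (perm_big _ (permEl (perm_rev _))) /=.
  rewrite -/(c _) -/(c _) -/(d _) -/(d _).
  move: (bigop _ (interior_row _ _ _) _) (c i) (d i) (d _) (c _) => I c1 d1 d2 c2 /=; lia.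
have sumE : (\sum_(i < n) (h i + h (N - i)%N) = n%:R - (\sum_(j < N.+1) (d j == -1)%R)%:R)%R.
  rewrite raddf_sum /= (sum_fold e) en.
  have := sum_interior f; rewrite (eq_bigr _ (fun i _ => rowE i)) (sum_fold c) sumrB sumr_const card_ord.
  set S1 := bigop _ _ _; set S2 := bigop _ _ _; set S3 := (X in (_ - (X + _))%R) => sumI.
  have -> : (\sum_(i < n) (h i + h (N - i)%N) = S1 + S2 - S3)%R.
    by rewrite -big_split -sumrB; apply: eq_bigr => i _; rewrite /h /=; ring.
  by move/(canRL (subrK _)): sumI => ->; ring.
have h_eq0 : (forall j, j <= N -> j != n -> h j = 0%R) <-> (\sum_(i < n) (h i + h (N - i)%N) = 0)%R.
  split=> [hj|sum0 j jN jn].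
    by rewrite big1 // => i _; have ilt := ltn_ord i; rewrite !hj ?addr0 //; lia.
  have hi i : i < n -> (0 <= h i)%R /\ (0 <= h (N - i)%N)%R.
    by move=> ilt; split; [have [|] := h0 i | have [|] := h0 (N - i)]; lia.
  have pair_ge0 (i : 'I_n) : (0 <= h i + h (N - i)%N)%R.
    by have [? ?] := hi i (ltn_ord i); apply: addr_ge0.
  have pair0 i (ilt : i < n) := psumr_eq0P (fun i _ => pair_ge0 i) sum0 (isT : xpredT (Ordinal ilt)).
  have {pair0} pair0 i : i < n -> h i = 0%R /\ h (N - i)%N = 0%R.
    move=> ilt; have [hi1 hi2] := hi i ilt; have /= := pair0 i ilt.
    by move/eqP; rewrite paddr_eq0 // => /andP[/eqP-> /eqP->].
  case: (ltngtP j n) jn => // [jlt|jgt] _; first by have [] := pair0 j jlt.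
  by have [|_] := pair0 (N - j); [lia | rewrite subKn].
rewrite sumE in h_eq0; split=> [bal|count].
  have /h_eq0 : forall j, j <= N -> j != n -> h j = 0%R.
    by move=> j jN jn; apply/(h0 j jN).2; apply: bal.
  by move/eqP; rewrite subr_eq0 eqr_nat => /eqP.
move=> j jN jn; apply/(h0 j jN).2; apply: h_eq0.2 j jN jn.
by rewrite count subrr.
Qed.

End Balance.

(** * Reconstruction of a matrix from its interior *)

Section Folding.

Variable n : nat.
Local Notation N := n.*2.
Implicit Types (f : nat -> nat -> int) (L : seq (seq int)) (A : 'M[entry]_(N.+1)).

Definition entries A i j := int_mx A (inord i) (inord j).

Lemma row_seq_entries A (i : 'I_N.+1) : row_seq (int_mx A) i = entry_line n (entries A) i.
Proof.
rewrite /entry_line -val_enum_ord -map_comp; apply: eq_map => j.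
by rewrite /entries /= !inord_val.
Qed.

Lemma entry_line_rev f i : symmetric_entries n f -> i <= N ->
  entry_line n f (N - i) = rev (entry_line n f i).
Proof.
move=> fS iN; rewrite /entry_line -map_rev rev_iota -map_comp; apply/eq_in_map => j.
rewrite mem_iota /= add0n ltnS => jN.
have [|//|_ ->] := fS (N - i) j; first by lia.
by have [||-> _] := fS (N - j) (N - (N - i)); [lia|lia|rewrite subKn].
Qed.

Lemma DASASM_entries A : A \in DASASM N.+1 <->
  symmetric_entries n (entries A)
  /\ (forall i, i <= n -> run false (entry_line n (entries A) i) = Some true).
Proof.
rewrite inE; split=> [/and3P[ASM_A /eqP dA /eqP aA]|[sA lines]].
  split=> [i j iN jN|i iN].
    split; rewrite /entries !mxE; first by rewrite -[in LHS]dA mxE.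
    rewrite -[in LHS]aA !mxE; congr (\val (A _ _)); apply: val_inj;
      by rewrite /= !inordK ?subSS //; lia.
  move: ASM_A; rewrite inE => /andP[/forallP/(_ (inord i)) + _].
  rewrite asm_line_run row_seq_entries inordK => [/eqP //|].
  by lia.
have dA : diag_reflection A = A.
  apply: int_mx_inj; apply/matrixP => i j; rewrite !mxE.
  by have := (sA j i _ _).1; rewrite /entries !mxE !inord_val; apply; rewrite -ltnS.
have aA : antidiag_reflection A = A.
  apply: int_mx_inj; apply/matrixP => i j; rewrite !mxE.
  have := (sA (rev_ord j) (rev_ord i) _ _).2; rewrite /entries !mxE !inord_val => ->.
  - congr (\val (A _ _)); apply: val_inj; rewrite /= inordK; have := ltn_ord i; have := ltn_ord j; lia.
  - by rewrite -ltnS.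
  - by rewrite -ltnS.
rewrite dA aA !eqxx !andbT inE.
have rows_ok i : asm_line (row_seq (int_mx A) i).
  rewrite asm_line_run row_seq_entries; apply/eqP; case: (leqP i n) => [/lines //|iN].
  have iN1 : i <= N by rewrite -ltnS.
  by rewrite -(subKn iN1) entry_line_rev ?leq_subr // (run_rev (lines _ _)) //; lia.
apply/andP; split; apply/forallP => // i.
rewrite (_ : col_seq _ _ = row_seq (int_mx A) i) //.
by apply: eq_map => j; rewrite -[in RHS]dA !mxE.
Qed.

Lemma minus_onesE m (P : {set 'I_m * 'I_m}) (A : 'M[entry]_m) :
  minus_ones P A = \sum_(i < m) \sum_(j < m) ((i, j) \in P) * (int_mx A i j == -1)%R.
Proof.
rewrite /minus_ones -sum1_card big_mkcond pair_big /=; apply: eq_bigr => -[i j] _ /=.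
by rewrite inE /=; case: (_ \in P); case: (_ == _).
Qed.

Lemma N_minus1_entries A :
  N_minus1 A = \sum_(j < N.+1) (diagonal_entry n (entries A) j == -1)%R.
Proof.
rewrite /N_minus1 minus_onesE exchange_big; apply: eq_bigr => j _ /=.
have jN := ltn_ord j; have mlt : minn j (N - j) < N.+1 by lia.
rewrite (bigD1 (Ordinal mlt)) //= big1 ?addn0 => [|i ij].
  rewrite inE /= /diagonal_entry /entries inord_val.
  rewrite (_ : inord _ = Ordinal mlt); last by apply: val_inj; rewrite /= inordK.
  rewrite [X in (nat_of_bool X) * _](_ : _ = true) ?mul1n //.
  by rewrite -!val_eqE /=; lia.
rewrite inE /= [X in (nat_of_bool X) * _](_ : _ = false) //.
by move: ij; rewrite -!val_eqE /=; lia.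
Qed.

Lemma mu_nabla_entries A :
  mu_nabla A = ((N_minus1 A + array_minus_count (interior n (entries A)))%:Z - n%:Z)%R.
Proof.
rewrite /mu_nabla; congr (Posz _ - _)%R.
rewrite array_minus_countE /N_minus1 !minus_onesE.
have -> : \sum_(r <- interior n (entries A)) \sum_(x <- r) (x == -1)%R
  = \sum_(i < N.+1) \sum_(j < N.+1) ((i < n) && (i < j < N - i)) * (int_mx A i j == -1)%R.
  rewrite big_map.
  have -> : iota 0 n = index_iota 0 n by rewrite /index_iota subn0.
  rewrite (big_nat_widen _ _ N.+1) /=; last by lia.
  rewrite big_mkord big_mkcond; apply: eq_bigr => i _ /=; case: ifP => [ilt|_]; last by rewrite big1.
  rewrite big_map.
  have -> : iota i.+1 (n - i).*2.-1 = index_iota i.+1 (N - i).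
    by rewrite /index_iota; congr iota; lia.
  rewrite (big_nat_widen _ _ N.+1) /=; last by lia.
  rewrite (big_nat_widenl _ 0) // big_mkord big_mkcond; apply: eq_bigr => j _.
  by rewrite /entries !inord_val andbC /=; case: (_ && _); rewrite /= ?mul1n.
rewrite -big_split; apply: eq_bigr => i _; rewrite -big_split; apply: eq_bigr => j _ /=.
rewrite -mulnDl; congr (_ * _); rewrite !inE /= -!val_eqE /=.
have := ltn_ord i; have := ltn_ord j; lia.
Qed.

Lemma symmetric_fold f i j : symmetric_entries n f -> i <= N -> j <= N ->
  f i j = if i + j <= N then f (minn i j) (maxn i j) else f (N - maxn i j) (N - minn i j).
Proof.
move=> fS iN jN; have [fT fA] := fS i j iN jN.
by case: ifP => _; case: (leqP i j) => // _; rewrite fT; have [] := fS j i jN iN.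
Qed.

(** Besides the interior, the fundamental triangle has only diagonal entries, fixed by balance, and
    the centre, which balance leaves open. The reflections give the rest. *)
Lemma symmetric_entries_determined f f' : symmetric_entries n f -> symmetric_entries n f' ->
  balanced n f -> balanced n f' -> interior n f = interior n f' -> f n n = f' n n ->
  forall i j, i <= N -> j <= N -> f i j = f' i j.
Proof.
move=> fS fS' bal bal' If center.
have fund i j : i <= j -> i + j <= N -> f i j = f' i j.
  move=> ij ijN; have jN : j <= N by lia.
  case: (boolP (i == minn j (N - j))) => [/eqP->|iD].
    case: (eqVneq j n) => [->|jn]; first by rewrite (_ : minn n (N - n) = n) //; lia.
    by have := bal j jN jn; have := bal' j jN jn; rewrite -!triangle_column_interior // If => <-.
  rewrite -(@nth_interior_row n) //; [|lia|lia]; rewrite -nth_interior; last by lia.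
  by rewrite If nth_interior ?nth_interior_row //; lia.
move=> i j iN jN; rewrite symmetric_fold // [RHS]symmetric_fold //.
by case: ifP => ijN; apply: fund; lia.
Qed.

Lemma entries_onto f : (forall i j, i <= N -> j <= N -> f i j \in [:: 0%R; 1%R; (-1)%R]) ->
  exists A, forall i j, i <= N -> j <= N -> entries A i j = f i j.
Proof.
move=> fE; have [|A AM] := @int_mx_onto _ (\matrix_(i < N.+1, j < N.+1) f i j)%R.
  by move=> i j; rewrite mxE; apply: fE; rewrite -ltnS.
by exists A => i j iN jN; rewrite /entries AM mxE !inordK.
Qed.

Lemma entry_line_ext f f' i : (forall i j, i <= N -> j <= N -> f i j = f' i j) -> i <= N ->
  entry_line n f i = entry_line n f' i.
Proof. by move=> ff' iN; apply/eq_in_map => j; rewrite mem_iota => /andP[_ jN]; apply: ff'. Qed.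

Lemma interior_ext f f' : (forall i j, i <= N -> j <= N -> f i j = f' i j) ->
  interior n f = interior n f'.
Proof.
move=> ff'; apply/eq_in_map => i; rewrite mem_iota => /andP[_ ilt].
by apply/eq_in_map => j; rewrite mem_iota => jN; apply: ff'; lia.
Qed.

Lemma balanced_ext f f' : (forall i j, i <= N -> j <= N -> f i j = f' i j) ->
  balanced n f -> balanced n f'.
Proof.
move=> ff' bal j jN jn; rewrite /diagonal_entry -ff' ?[LHS]bal //; last by lia.
by rewrite -!triangle_column_interior // (interior_ext ff').
Qed.

Lemma symmetric_entries_ext f f' : (forall i j, i <= N -> j <= N -> f i j = f' i j) ->
  symmetric_entries n f -> symmetric_entries n f'.
Proof. by move=> ff' fS i j iN jN; rewrite -!ff' ?leq_subr //; apply: fS. Qed.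

(** Diagonal cells are filled by balance; for a triangle array this also puts -1 at the centre, as
    the central column sums to 1. *)
Definition cell L i j :=
  if (j == i) || (j == N - i) then (- \sum_(x <- triangle_column n j L) x)%R
  else nth 0%R (nth [::] L i) (j - i.+1).

Definition unfold_triangle L i j :=
  if i + j <= N then cell L (minn i j) (maxn i j) else cell L (N - maxn i j) (N - minn i j).

Lemma unfold_triangle_symmetric L : symmetric_entries n (unfold_triangle L).
Proof.
move=> i j iN jN; split; first by rewrite /unfold_triangle addnC minnC maxnC.
rewrite /unfold_triangle; case: (ltngtP (i + j) N) => ij.
- rewrite leqNgt (_ : N < _) /=; last by lia.
  by congr cell; lia.
- rewrite (_ : N - j + (N - i) <= N); last by lia.
  by congr cell; lia.
rewrite (_ : N - j + (N - i) <= N); last by lia.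
by congr cell; lia.
Qed.

Lemma interior_unfold L : size L = n -> (forall i, i < n -> size (nth [::] L i) = (n - i).*2.-1) ->
  interior n (unfold_triangle L) = L.
Proof.
move=> szL szr; apply: (@eq_from_nth _ [::]) => [|i]; rewrite size_map size_iota // => ilt.
rewrite nth_interior //; apply: (@eq_from_nth _ 0%R); rewrite size_map size_iota ?szr // => j jlt.
rewrite (nth_map 0) ?size_iota // nth_iota // /unfold_triangle.
rewrite (_ : i + (i.+1 + j) <= N); last by lia.
have [-> ->] : minn i (i.+1 + j) = i /\ maxn i (i.+1 + j) = i.+1 + j by split; lia.
rewrite /cell ifF ?addKn //; lia.
Qed.

Lemma diagonal_entry_unfold L j : j <= N ->
  diagonal_entry n (unfold_triangle L) j = (- \sum_(x <- triangle_column n j L) x)%R.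
Proof.
move=> jN; rewrite /diagonal_entry /unfold_triangle; set i := minn j (N - j).
have [-> -> ->] : [/\ i + j <= N, minn i j = i & maxn i j = j] by rewrite /i; split; lia.
by rewrite /cell ifT // /i; lia.
Qed.

Lemma triangle_DASASM L : 0 < n -> L \in triangle_arrays n (nseq N.+1 false) ->
  exists2 A, A \in [set A in DASASM N.+1 | N_minus1 A == n] & L = interior n (entries A).
Proof.
move=> n0 inL; have := inL; case/(triangle_arraysP _ (size_nseq _ _)) => szL rL _ mL.
pose f := unfold_triangle L.
have fS : symmetric_entries n f by exact: unfold_triangle_symmetric.
have fL : interior n f = L by apply: interior_unfold => // i /rL[].
have bal : balanced n f.
  by move=> j jN _; rewrite -triangle_column_interior // fL diagonal_entry_unfold.
have center : f n n = (-1)%R.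
  have := @diagonal_entry_unfold L n; rewrite /diagonal_entry (_ : minn n (N - n) = n); last by lia.
  rewrite -/f => ->; last by lia.
  by have := run_sum mL; rewrite nth_nseq if_same add0r => ->.
have lines : forall i, i <= n -> run false (entry_line n f i) = Some true.
  by apply/(interior_triangle n0 fS bal); rewrite fL.
have [|A AF] := @entries_onto f.
  (* Rows down to the centre are alternating sign lines; the entries of lower rows are mirror images
     of theirs. *)
  have small i j : i <= n -> j <= N -> f i j \in [:: 0%R; 1%R; (-1)%R].
    move=> iN jN; apply: (@run_entries false (entry_line n f i)); first by rewrite lines.
    by apply/mapP; exists j; rewrite // mem_iota.
  move=> i j iN jN; case: (leqP i n) => [iN'|iN']; first exact: small.
  have [-> _] := fS i j iN jN; have [_ ->] := fS j i jN iN.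
  by apply: small; lia.
have fA i j : i <= N -> j <= N -> f i j = entries A i j by move=> *; rewrite AF.
have AS := symmetric_entries_ext fA fS; have Abal := balanced_ext fA bal.
have Alines i : i <= n -> run false (entry_line n (entries A) i) = Some true.
  by move=> iN; rewrite -(entry_line_ext fA) ?lines //; lia.
exists A; last by rewrite -fL; apply: interior_ext.
rewrite inE; apply/andP; split; first exact/DASASM_entries.
by rewrite N_minus1_entries; apply/eqP/(balanced_count AS Alines).
Qed.

(** The list [l] and the central entry are left open in order to cover [n = 0], where the central
    entry is 1 instead of -1. When [N_minus1 A = n], the diagonal part of [mu_nabla] cancels the
    subtracted [n]. *)
Lemma card_DASASM m (l : seq (seq (seq int))) (center : int) :
  (forall A, A \in DASASM N.+1 -> N_minus1 A = n ->
     interior n (entries A) \in l /\ entries A n n = center) ->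
  uniq l ->
  (forall L, L \in l ->
     exists2 A, A \in [set A in DASASM N.+1 | N_minus1 A == n] & L = interior n (entries A)) ->
  #|[set A in DASASM N.+1 | (N_minus1 A == n) && (mu_nabla A == m%:Z)%R]|
  = count (fun L => array_minus_count L == m) l.
Proof.
move=> inl ul onto.
rewrite -(card_count (S := [set A in DASASM N.+1 | N_minus1 A == n])
            (f := fun A => interior n (entries A))) //.
- apply: eq_card => A; rewrite !inE mu_nabla_entries; case: (N_minus1 A =P n) => [->|_]; last by rewrite !andbF.
  by rewrite !andbT andTb PoszD addrAC subrr add0r.
- move=> A B /setIdP[AD /eqP AN] /setIdP[BD /eqP BN] AB.
  have [_ cA] := inl A AD AN; have [_ cB] := inl B BD BN.
  have [AS Al] := (DASASM_entries A).1 AD; have [BS Bl] := (DASASM_entries B).1 BD.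
  move: AN BN; rewrite !N_minus1_entries => /(balanced_count AS Al) Abal /(balanced_count BS Bl) Bbal.
  have AB' := symmetric_entries_determined AS BS Abal Bbal AB (etrans cA (esym cB)).
  apply: int_mx_inj; apply/matrixP => i j.
  by have := AB' i j; rewrite /entries !inord_val; apply; rewrite -ltnS.
move=> L; split=> [/onto //|[A /setIdP[AD /eqP AN] ->]].
by have [] := inl A AD AN.
Qed.

End Folding.

Lemma card_DASASM0 m :
  #|[set A in DASASM 0.*2.+1 | (N_minus1 (n := 0) A == 0) && (mu_nabla (n := 0) A == m%:Z)%R]|
  = (0 == m).
Proof.
rewrite (@card_DASASM 0 m [:: [::]] 1%R) // => [|A /DASASM_entries[AS lines] _|L]; first exact: addn0.
  split=> //; have := run_entry_line_center AS (erefl : run false (upper_column 0 _ 0) = Some false).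
  by rewrite lines // eqxx => /esym/eqP->.
rewrite inE => /eqP->; have [|A AE] := @entries_onto 0 (fun _ _ => 1%R); first by [].
exists A => //; rewrite inE; apply/andP; split.
  apply/DASASM_entries; split=> [i j iN jN|i]; first by rewrite !AE.
  by rewrite leqn0 => /eqP->; rewrite /entry_line /= AE.
by rewrite N_minus1_entries big_ord1 /diagonal_entry AE.
Qed.

Theorem theorem1p2 (m n : nat) :
  #|[set A in ASM n | mu A == m]|
  = #|[set A in DASASM n.*2.+1 | (N_minus1 A == n) && (mu_nabla A == m%:Z)%R]|.
Proof.
rewrite card_ASM; case: n => [|n]; first by rewrite card_DASASM0 /= addn0.
rewrite -count_arrays (@card_DASASM n.+1 m (triangle_arrays n.+1 (nseq n.+1.*2.+1 false)) (-1)%R) //.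
- move=> A /DASASM_entries[AS lines]; rewrite N_minus1_entries => /(balanced_count AS lines) bal.
  exact: (interior_triangle _ AS bal).1.
- exact: uniq_triangle_arrays.
by move=> L; apply: triangle_DASASM.
Qed.
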